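(* There is a universal constant $C$ such that for every $p>1$ and $q\in[2,\infty)$, every Banach space $(E,\|\cdot\|_E)$ with $K_q(E)<\infty$, and every smooth compactly supported $f\colon\mathbb{R}^3\to E$, $$\left(\int_0^\infty\|D_{\mathsf v}^tf\|_{L_p(\mathbb{R}^3;E)}^{\max\{p,q\}}\frac{\mathrm dt}{t}\right)^{\frac{1}{\max\{p,q\}}}\le C\max\Big\{(p-1)^{\frac1q-1},K_q(E)\Big\}\left(\int_{\mathbb{R}^3}\big(\|\mathsf Xf(h)\|_E^p+\|\mathsf Yf(h)\|_E^p\big)\mathrm dh\right)^{1/p}.$$
   Context: For $h=(x,y,z)$: $\mathsf Xf=\partial_xf+\frac12y\,\partial_zf$, $\mathsf Yf=\partial_yf-\frac12x\,\partial_zf$, and $D_{\mathsf v}^tf(h)=\frac{f(x,y,z+t)-f(h)}{\sqrt t}$; $L_p(\mathbb{R}^3;E)$ is the Bochner space for Lebesgue measure. For $q\ge2$, $K_q(E)$ is the infimum of $K\in(0,\infty]$ such that $\|x\|_E^q+K^{-q}\|y\|_E^q\le\frac12\|x+y\|_E^q+\frac12\|x-y\|_E^q$ for all $x,y\in E$. *)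

(* Defs.v *)
From HB Require Import structures.
From mathcomp Require Import all_boot all_order all_algebra.
From mathcomp Require Import all_classical all_reals all_analysis.
Set Implicit Arguments. Unset Strict Implicit. Unset Printing Implicit Defensive.
Import Order.TTheory GRing.Theory Num.Theory.
Import numFieldNormedType.Exports.
Local Open Scope classical_set_scope.
Local Open Scope ring_scope.

Section Heisenberg.
Variable R : realType.
Variable E : normedModType R.

Inductive coord := Cx | Cy | Cz.

Definition slice (d : coord) (h : (R * R) * R) (s : R) : (R * R) * R :=
  match d with
  | Cx => ((s, h.1.2), h.2)
  | Cy => ((h.1.1, s), h.2)
  | Cz => ((h.1.1, h.1.2), s)
  end.

Definition coordv (d : coord) (h : (R * R) * R) : R :=
  match d with Cx => h.1.1 | Cy => h.1.2 | Cz => h.2 end.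

Definition partial (d : coord) (g : (R * R) * R -> E) : (R * R) * R -> E :=
  fun h => derive1 (fun s => g (slice d h s)) (coordv d h).

Fixpoint iter_partial (ds : seq coord) (g : (R * R) * R -> E) :=
  match ds with
  | [::] => g
  | d :: ds' => partial d (iter_partial ds' g)
  end.

Definition smooth (g : (R * R) * R -> E) : Prop :=
  forall ds : seq coord,
    continuous (iter_partial ds g) /\
    forall (d : coord) (h : (R * R) * R),
      derivable (fun s => iter_partial ds g (slice d h s)) (coordv d h) 1.

Definition compact_support (g : (R * R) * R -> E) : Prop :=
  exists r : R, forall h : (R * R) * R,
    r < `|h.1.1| \/ r < `|h.1.2| \/ r < `|h.2| -> g h = 0.

Definition Xf (g : (R * R) * R -> E) (h : (R * R) * R) : E :=
  partial Cx g h + (h.1.2 / 2) *: partial Cz g h.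
Definition Yf (g : (R * R) * R -> E) (h : (R * R) * R) : E :=
  partial Cy g h - (h.1.1 / 2) *: partial Cz g h.

Definition Dv (t : R) (g : (R * R) * R -> E) (h : (R * R) * R) : E :=
  (Num.sqrt t)^-1 *: (g ((h.1.1, h.1.2), h.2 + t) - g h).

End Heisenberg.

Notation leb3 R :=
  ((@lebesgue_measure R \x @lebesgue_measure R) \x @lebesgue_measure R)%E.

Definition Kq (R : realType) (E : normedModType R) (q : R) : \bar R :=
  ereal_inf ([set (K%:E)%E | K in [set K : R | 0 < K /\
      forall x y : E, `|x| `^ q + K `^ (- q) * `|y| `^ q <=
                      2^-1 * `|x + y| `^ q + 2^-1 * `|x - y| `^ q]]
             `|` [set +oo%E]).

(* Main.v *)
Require Import Defs.
From HB Require Import structures.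
From mathcomp Require Import all_boot all_order all_algebra.
From mathcomp Require Import all_classical all_reals all_analysis.
From mathcomp Require Import measurable_realfun.
From mathcomp Require Import ring lra.
Set Implicit Arguments. Unset Strict Implicit. Unset Printing Implicit Defensive.
Import Order.TTheory GRing.Theory Num.Theory.
Import numFieldNormedType.Exports.
Local Open Scope classical_set_scope.
Local Open Scope ring_scope.

(** The space L_p(R^3; E) inherits from E an m-uniform convexity inequality,
    m = max(p, q), with constant comparable to max((p-1)^(1/q-1), K_q(E)).
    Let T_k be the vertical translation by 2^k t, so that T_{k+1} = T_k T_k,
    and let B_k be the product of the averages (1 + T_j)/2 over j < k.  The
    convexity inequality applied at each k to x = B_{k+1} u and
    y = (T_k - 1) B_k u / 2 telescopes, which controls the l_m sum over k of the
    norms of the Haar differences h_k u = (T_k - 1) B_k u, for u = X f and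
    u = Y f.  Since h_k commutes with the horizontal flows, and the vertical
    translation by s is a commutator of horizontal flows at time sqrt(s), one has
    |(T_k - 1) h_k f| <= 2 sqrt(2^k t) (|h_k X f| + |h_k Y f|).  As h_{k+1} =
    2 h_k + O((T_k - 1) h_k) while sqrt(2^k t) grows only by the factor sqrt 2,
    this gives the l_m bound for h_k f / sqrt(2^k t), then the one for
    (T_k - 1) f / sqrt(2^k t), and it remains to integrate over t in a dyadic
    interval. *)

(** * Dyadic translations in a uniformly convex space *)

(** The inheritance by L_p rests on a two-point inequality in E of mixed form, which bounds |x|^m +
    kappa |y|^m by the power m/p of the mean of |x + y|^p and |x - y|^p. Since m >= p, it passes to
    L_p by a reverse Minkowski inequality with exponent m/p. For p < q its gain has two sources: the
    strict convexity of t^p, where the factor p - 1 enters, when |x + y| and |x - y| differ much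
    compared with |y|, and the convexity of E otherwise. The exchange between scales uses two
    geometric recursions of opposite directions. One bounds h_k f by h_{k+1} f, so its boundary term
    sits at large k, where h_k f / sqrt(2^k t) is small because h_k f stays bounded. The other
    recovers (T_j - 1) f from the h_k f with k <= j. Both contract because sqrt 2 lies strictly
    between 1 and 2. *)

Section PowerConvexity.
Variable R : realType.
Implicit Types (m r u v w : R).

Lemma powR_convex m t u v : 1 <= m -> 0 <= t <= 1 -> 0 <= u -> 0 <= v ->
  (t * u + (1 - t) * v) `^ m <= t * u `^ m + (1 - t) * v `^ m.
Proof.
move=> m1 /andP[t0 t1] u0 v0.
by apply: (convex_powR m1 (Itv01 t0 t1)) => //=; rewrite ?inE/= ?in_itv/= ?u0 ?v0.
Qed.

Lemma ler_powR2r m u v : 0 <= m -> 0 <= u -> u <= v -> u `^ m <= v `^ m.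
Proof.
by move=> m0 u0 uv; apply: ge0_ler_powR => //; rewrite nnegrE ?(le_trans u0).
Qed.

(** Writing v as (1 - t) * (v / (1 - t)) keeps the coefficient t of u after raising to the power m.
    A recursion with contraction factor t < 1 thus becomes one for m-th powers, which can be
    summed. *)
Lemma powRD_le m t u v : 1 <= m -> 0 < t < 1 -> 0 <= u -> 0 <= v ->
  (t * u + v) `^ m <= t * u `^ m + (1 - t) * (v / (1 - t)) `^ m.
Proof.
move=> m1 /andP[t0 t1] u0 v0.
have t1' : 0 < 1 - t by rewrite subr_gt0.
rewrite -{1}(@divfK _ (1 - t) _ v) ?gt_eqF// [v / _ * _]mulrC.
by apply: powR_convex => //; rewrite ?divr_ge0 ?(ltW t0) ?(ltW t1) ?(ltW t1').
Qed.

Lemma powRD2_le m u v : 1 <= m -> 0 <= u -> 0 <= v ->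
  (u + v) `^ m <= 2 `^ m * (2^-1 * (u `^ m + v `^ m)).
Proof.
move=> m1 u0 v0.
have -> : u + v = 2 * (2^-1 * u + (1 - 2^-1) * v) by field.
have c0 : 0 <= 2^-1 * u + (1 - 2^-1) * v by lra.
have h01 : 0 <= (2^-1 : R) <= 1 by lra.
rewrite powRM// ler_wpM2l ?powR_ge0//.
by have := powR_convex m1 h01 u0 v0; lra.
Qed.

End PowerConvexity.

Section DyadicTranslations.
Variables (R : realType) (V : lmodType R) (N : V -> R).
Hypothesis N_ge0 : forall u, 0 <= N u.
Hypothesis ler_ND : forall u v, N (u + v) <= N u + N v.
Hypothesis NZ : forall (a : R) u, N (a *: u) = `|a| * N u.
Variables (m kappa : R).
Hypothesis m1 : 1 <= m.
Hypothesis kappa0 : 0 < kappa.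
Hypothesis N_convex : forall x y,
  N x `^ m + kappa * N y `^ m <= 2^-1 * (N (x + y) `^ m + N (x - y) `^ m).
Variable T : nat -> {linear V -> V}.
Hypothesis NT : forall k u, N (T k u) = N u.
Hypothesis T_double : forall k u, T k.+1 u = T k (T k u).

Let m0 : 0 <= m. Proof. by rewrite (le_trans _ m1). Qed.

Let NN u : N (- u) = N u.
Proof. by rewrite -scaleN1r NZ normrN1 mul1r. Qed.

Let ler_NB u v : N (u - v) <= N u + N v.
Proof. by rewrite -[N v]NN ler_ND. Qed.

Let diff_split (x y z w : V) : x - y = (x + z - (y + w)) - (z - w).
Proof. by rewrite (opprD y) addrACA addrK. Qed.

Let half_double (u : V) : 2^-1 *: (u + u) = u.
Proof. by rewrite scalerDr -scalerDl (_ : 2^-1 + 2^-1 = 1) ?scale1r//; field. Qed.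

Let half_step (S : {linear V -> V}) b d :
  S b - b = (S (b + 2^-1 *: d) - (b + 2^-1 *: d)) - 2^-1 *: (S d - d).
Proof. by rewrite [S (b + _)]linearD [S (_ *: d)]linearZ /= scalerBr -diff_split. Qed.

Fixpoint dyadic_avg k (u : V) : V :=
  if k is k'.+1 then 2^-1 *: (T k' (dyadic_avg k' u) + dyadic_avg k' u) else u.

Definition dyadic_diff k u := T k (dyadic_avg k u) - dyadic_avg k u.

Local Notation B := dyadic_avg.
Local Notation h := dyadic_diff.

Lemma dyadic_avgS k u : B k.+1 u = B k u + 2^-1 *: h k u.
Proof.
rewrite /= /h scalerBr scalerDr addrCA; congr (_ + _).
rewrite -[X in X - _]scale1r -scalerBl; congr (_ *: _); by field.
Qed.

Lemma dyadic_square_function n u :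
  \sum_(k < n) kappa * N (2^-1 *: h k u) `^ m <= N u `^ m.
Proof.
suff : \sum_(k < n) kappa * N (2^-1 *: h k u) `^ m + N (B n u) `^ m <= N u `^ m.
  by apply: le_trans; rewrite lerDl powR_ge0.
elim: n => [|n IHn]; first by rewrite big_ord0 add0r.
rewrite big_ord_recr/= -addrA; apply: le_trans IHn; rewrite lerD2l.
(* For x = B_{n+1} u and y = h_n u / 2, the vectors x + y = T_n B_n u and x - y = B_n u have the
   same norm. *)
rewrite [leLHS]addrC; apply: le_trans (N_convex _ _) _.
rewrite /h -scalerDr -scalerBr addrACA subrr addr0.
rewrite opprB [T n _ + B n u]addrC addrACA subrr addr0.
by rewrite !half_double NT; lra.
Qed.

Lemma N_dyadic_avg k u : N (B k u) <= N u.
Proof.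
elim: k => //= k IHk; rewrite NZ ger0_norm ?invr_ge0//.
have := ler_ND (T k (B k u)) (B k u); rewrite NT => ?; lra.
Qed.

Lemma N_dyadic_diff k u : N (h k u) <= 2 * N u.
Proof. by apply: le_trans (ler_NB _ _) _; rewrite NT; have := N_dyadic_avg k u; lra. Qed.

(** By [T_double], h_{k+1} u = (T_k + 1)(T_k - 1) B_{k+1} u, and (T_k - 1) B_{k+1} u = h_k u + w /
    2. *)
Lemma dyadic_diffS k u (w := T k (h k u) - h k u) :
  h k.+1 u = 2 *: h k u + ((3 / 2) *: w + 2^-1 *: T k w).
Proof.
have Tsub x : T k (T k x) - x = T k (T k x - x) + (T k x - x).
  by rewrite linearB addrA subrK.
have E : T k (B k.+1 u) - B k.+1 u = h k u + 2^-1 *: w.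
  by rewrite dyadic_avgS linearD linearZ /= opprD addrACA -scalerBr.
rewrite {1}/h T_double Tsub E linearD linearZ /= -[X in X + _ + _](subrK (h k u)) -/w.
have -> : 2 *: h k u = h k u + h k u by rewrite scaler_nat.
have -> : (3 / 2 : R) = 1 + 2^-1 by field.
by rewrite scalerDl scale1r [LHS](AC (3 * 2) (2 * 4 * (1 * 5 * 3))).
Qed.

Lemma N_dyadic_diff_next k u :
  N (h k u) <= 2^-1 * N (h k.+1 u) + N (T k (h k u) - h k u).
Proof.
have := dyadic_diffS k u; set w := T k (h k u) - h k u => hS.
have -> : h k u = 2^-1 *: h k.+1 u - 2^-1 *: ((3 / 2) *: w + 2^-1 *: T k w).
  by rewrite -scalerBr hS addrK scalerA mulVf// scale1r.
apply: le_trans (ler_NB _ _) _; rewrite !NZ ger0_norm ?invr_ge0// lerD2l.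
have := ler_ND ((3 / 2) *: w) (2^-1 *: T k w); rewrite !NZ NT !ger0_norm//; lra.
Qed.

(** B_n u differs from u by half the sum of the h_k u with k < n, and S - 1 at most doubles norms.
    With S = T_n the first term on the right is the norm of h_n u. *)
Lemma N_sub_le_sum_dyadic_diff (S : {linear V -> V}) n u :
  (forall v, N (S v) = N v) ->
  N (S u - u) <= N (S (B n u) - B n u) + \sum_(k < n) N (h k u).
Proof.
move=> NS; elim: n => [|n IHn]; first by rewrite big_ord0 addr0.
apply: le_trans IHn _; rewrite dyadic_avgS.
set b := B n u; set d := h n u.
rewrite [in leRHS]big_ord_recr/= -/d.
suff : N (S b - b) <= N (S (b + 2^-1 *: d) - (b + 2^-1 *: d)) + N d by lra.
rewrite (half_step S b d).
apply: le_trans (ler_NB _ _) _; rewrite lerD2l NZ ger0_norm ?invr_ge0//.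
have := ler_NB (S d) d; rewrite NS; lra.
Qed.

Variable s : nat -> R.
Hypothesis s0 : forall k, 0 < s k.
(** Meant for s_k = sqrt(2^k t), of ratio sqrt 2. The upper bound gives the factor 1/2 * 3/2 = 3/4
    in [alpha_rec]; the lower bound gives the same factor in the recursion behind
    [sum_sub_le_sum_alpha]. *)
Hypothesis s_growth : forall k, 4 / 3 * s k <= s k.+1 <= 3 / 2 * s k.
Variables (f a b : V).
Hypothesis poincare : forall k,
  N (T k (h k f) - h k f) <= 2 * s k * (N (h k a) + N (h k b)).

Let alpha k := N (h k f) / s k.
Let beta k := N (h k a) + N (h k b).

Let alpha_ge0 k : 0 <= alpha k. Proof. by rewrite divr_ge0// ltW. Qed.
Let beta_ge0 k : 0 <= beta k. Proof. exact: addr_ge0. Qed.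

Let alpha_rec k : alpha k <= 3 / 4 * alpha k.+1 + 2 * beta k.
Proof.
rewrite /alpha ler_pdivrMr// mulrDl.
apply: le_trans (N_dyadic_diff_next _ _) _; apply: lerD; last first.
  by apply: le_trans (poincare k) _; rewrite mulrAC.
have /andP[_ sk] := s_growth k.
have : N (h k.+1 f) / s k.+1 * s k.+1 <= N (h k.+1 f) / s k.+1 * (3 / 2 * s k).
  by rewrite ler_wpM2l ?divr_ge0// ltW.
rewrite divfK ?gt_eqF//; nra.
Qed.

Let s_geometric n : s 0%N * (4 / 3) ^+ n <= s n.
Proof.
elim: n => [|n IHn]; first by rewrite expr0 mulr1.
rewrite exprS mulrCA; have /andP[+ _] := s_growth n; apply: le_trans.
by rewrite ler_wpM2l//; lra.
Qed.

Let alpha_small (e : R) n : 0 < e -> exists2 l, (n <= l)%N & alpha l <= e.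
Proof.
move=> e0.
have /cvgrPdist_lt/(_ (e * s 0%N / (2 * N f + 1))) :
    geometric (1 : R) (3 / 4) n @[n --> \oo] --> 0.
  by apply: cvg_geometric; rewrite ger0_norm; lra.
have Nf1 : 0 < 2 * N f + 1 by rewrite ltr_wpDl// mulr_ge0.
case; first by rewrite divr_gt0// mulr_gt0.
move=> M _ HM; exists (maxn n M); first exact: leq_maxl.
have /= := HM (maxn n M) (leq_maxr _ _); rewrite sub0r normrN mul1r ger0_norm ?exprn_ge0//.
set l := maxn n M; rewrite ltr_pdivlMr// => /ltW small.
rewrite /alpha ler_pdivrMr//.
apply: le_trans (ler_wpM2l (ltW e0) (s_geometric l)).
have : (3 / 4 : R) ^+ l * (4 / 3) ^+ l = 1.
  by rewrite -exprMn (_ : 3 / 4 * (4 / 3) = 1) ?expr1n//; field.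
have := N_dyadic_diff l f; set x := _ ^+ l; set y := _ ^+ l.
have y0 : 0 < y by rewrite exprn_gt0//; lra.
move: small => /(ler_wpM2r (ltW y0)); rewrite -/x.
set Nh := N (h l f); set Nf := N f; set s' := s 0%N => E1 E2 E3.
rewrite mulrAC E3 mul1r in E1; lra.
Qed.

(** The m-th power of [alpha_rec], summed over k < l, gives S <= 3/4 (S + alpha_l^m) + 8^m bd / 4,
    the shift of index costing the boundary term alpha_l^m. Absorbing S leaves S <= 3 alpha_l^m +
    8^m bd, and [alpha_small] makes the boundary term negligible. *)
Lemma sum_alpha_le n (bd : R) : (forall l, \sum_(k < l) beta k `^ m <= bd) ->
  \sum_(k < n) alpha k `^ m <= 8 `^ m * bd.
Proof.
move=> Hbd.
have step l : \sum_(k < l) alpha k `^ m <= 3 * alpha l `^ m + 8 `^ m * bd.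
  have rec k : alpha k `^ m <= 3 / 4 * alpha k.+1 `^ m + 4^-1 * (8 `^ m * beta k `^ m).
    apply: le_trans (ler_powR2r m0 (alpha_ge0 k) (alpha_rec k)) _.
    apply: le_trans (powRD_le m1 _ (alpha_ge0 _) _) _; [lra|by rewrite mulr_ge0|].
    rewrite -powRM ?beta_ge0// (_ : 1 - 3 / 4 = 4^-1); last by field.
    by rewrite invrK (_ : 2 * _ * 4 = 8 * beta k)//; ring.
  have : \sum_(k < l) alpha k `^ m <=
      3 / 4 * (\sum_(k < l) alpha k.+1 `^ m) + 4^-1 * (8 `^ m * bd).
    have : \sum_(k < l) alpha k `^ m <=
        \sum_(k < l) (3 / 4 * alpha k.+1 `^ m + 4^-1 * (8 `^ m * beta k `^ m)).
      by apply: ler_sum => k _; exact: rec.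
    move=> /le_trans; apply.
    rewrite big_split/= -!mulr_sumr lerD2l ler_pM2l// ler_pM2l ?powR_gt0//.
    exact: Hbd.
  have : \sum_(k < l) alpha k.+1 `^ m <= \sum_(k < l) alpha k `^ m + alpha l `^ m.
    have -> : \sum_(k < l) alpha k `^ m + alpha l `^ m = \sum_(k < l.+1) alpha k `^ m.
      by rewrite big_ord_recr.
    rewrite big_ord_recl/=.
    by rewrite lerDr powR_ge0.
  by lra.
apply/ler_addgt0Pr => e e0.
(* The bound by 1 ensures alpha_l^m <= alpha_l. *)
have [|l nl al] := @alpha_small (Num.min 1 (e / 3)) n.
  by rewrite lt_min ltr01 divr_gt0.
have am : alpha l `^ m <= e / 3.
  move: al; rewrite le_min => /andP[a1 ae].
  have [->|a0] := eqVneq (alpha l) 0; first by rewrite powR0 ?gt_eqF ?divr_ge0 ?ltW// (lt_le_trans ltr01).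
  apply: le_trans ae; apply: ge1r_powR => //; rewrite a1 lt_neqAle eq_sym a0 alpha_ge0//.
have : \sum_(k < n) alpha k `^ m <= \sum_(k < l) alpha k `^ m.
  rewrite -(subnKC nl) -[leRHS](big_mkord xpredT (fun k => alpha k `^ m)).
  rewrite (big_cat_nat (leq0n n))/= ?leq_addr// big_mkord lerDl.
  by apply: sumr_ge0 => *; exact: powR_ge0.
have := step l; lra.
Qed.

(** A discrete Hardy inequality: since s grows geometrically, the partial sums of the norms of h_k
    f, divided by s_j, satisfy e_{j+1} <= 3/4 e_j + alpha_{j+1}. *)
Lemma sum_sub_le_sum_alpha n :
  \sum_(j < n) (N (T j f - f) / s j) `^ m <= 4 `^ m * \sum_(k < n) alpha k `^ m.
Proof.
pose e j := (\sum_(k < j.+1) N (h k f)) / s j.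
have e_ge0 j : 0 <= e j by rewrite divr_ge0 ?sumr_ge0// ltW.
have suff_e j : N (T j f - f) / s j <= e j.
  rewrite ler_pM2r ?invr_gt0// big_ord_recr/= addrC.
  exact: N_sub_le_sum_dyadic_diff.
apply: (@le_trans _ _ (\sum_(j < n) e j `^ m)).
  by apply: ler_sum => j _; apply: ler_powR2r => //; rewrite divr_ge0// ltW.
have e_rec j : e j.+1 <= 3 / 4 * e j + alpha j.+1.
  rewrite /e big_ord_recr/= mulrDl lerD2r.
  rewrite ler_pdivrMr// mulrC -!mulrA; have /andP[sj _] := s_growth j.
  have : (\sum_(k < j.+1) N (h k f)) / s j * (4 / 3 * s j) <=
         (\sum_(k < j.+1) N (h k f)) / s j * s j.+1 by rewrite ler_wpM2l// e_ge0.
  rewrite mulrCA divfK ?gt_eqF//; lra.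
case: n => [|n]; first by rewrite !big_ord0 mulr0.
(* The extra term closes the induction, because 4 e_{n+1}^m <= 3 e_n^m + 4^m alpha_{n+1}^m. *)
suff : \sum_(j < n.+1) e j `^ m + 3 * e n `^ m <= 4 `^ m * \sum_(k < n.+1) alpha k `^ m.
  by apply: le_trans; rewrite lerDl mulr_ge0 ?powR_ge0.
elim: n => [|n IHn].
  rewrite !big_ord1 /e big_ord1 -/(alpha 0).
  have : 4 <= 4 `^ m :> R by rewrite le1r_powR//; lra.
  have := powR_ge0 (alpha 0) m; nra.
rewrite big_ord_recr/= [in leRHS]big_ord_recr/= mulrDr.
have : e n.+1 `^ m <= 3 / 4 * e n `^ m + 4^-1 * (4 `^ m * alpha n.+1 `^ m).
  apply: le_trans (ler_powR2r m0 (e_ge0 _) (e_rec n)) _.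
  apply: le_trans (powRD_le m1 _ (e_ge0 _) (alpha_ge0 _)) _; first lra.
  rewrite -powRM// (_ : 1 - 3 / 4 = 4^-1); last by field.
  by rewrite invrK [_ * 4]mulrC.
by lra.
Qed.

(** 128 = 4 * 8 * 2 * 2: 4 comes from [sum_sub_le_sum_alpha], 8 from [sum_alpha_le], one 2 undoes
    the half in [dyadic_square_function], and the other adds the contributions of a and b through
    [powRD2_le]. *)
Theorem dyadic_translation_bound n (G : R) : N a <= G -> N b <= G ->
  \sum_(j < n) (N (T j f - f) / s j) `^ m <= 128 `^ m / kappa * G `^ m.
Proof.
move=> aG bG.
have sum_h l v : N v <= G -> \sum_(k < l) N (h k v) `^ m <= 2 `^ m / kappa * G `^ m.
  move=> vG; rewrite mulrAC ler_pdivlMr// mulr_suml.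
  have := dyadic_square_function l v.
  under eq_bigr do rewrite NZ powRM// ger0_norm ?invr_ge0//.
  have := ler_powR2r m0 (N_ge0 v) vG => /[swap] /le_trans/[apply].
  have c0 : 0 < 2 `^ m :> R by rewrite powR_gt0.
  rewrite -(ler_pM2l c0) => /(le_trans _); apply; rewrite mulr_sumr.
  apply: ler_sum => k _; rewrite mulrCA -powR_inv1// -powRrM mulN1r powRN.
  by rewrite [2 `^ m * _]mulrA mulfV ?gt_eqF// mul1r mulrC.
apply: le_trans (sum_sub_le_sum_alpha n) _.
apply: le_trans (ler_wpM2l (powR_ge0 _ _) (@sum_alpha_le n (4 `^ m / kappa * G `^ m) _)) _.
  move=> l; have := sum_h l _ aG; have := sum_h l _ bG.
  set cA := _ / kappa * _ => SA SB.
  have -> : 4 `^ m / kappa * G `^ m = 2 `^ m * cA.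
    by rewrite /cA !mulrA -powRM// -natrM.
  apply: (@le_trans _ _ (2 `^ m * (2^-1 * (\sum_(k < l) N (h k a) `^ m + \sum_(k < l) N (h k b) `^ m)))).
    rewrite -big_split/= !mulr_sumr; apply: ler_sum => k _; exact: powRD2_le.
  by rewrite ler_wpM2l ?powR_ge0//; lra.
rewrite !mulrA -!powRM// -!natrM lexx//.
Qed.

End DyadicTranslations.

(** * Two-point inequalities *)

Section TwoPoint.
Variable R : realType.
Implicit Types p q s u v M d K kappa : R.

(** u^p = u u^(p-1) >= u (1 + (p - 1) ln u), and ln u = 2 ln(sqrt u) >= 2 (1 - 1 / sqrt u). The
    square root makes the bound algebraic while p - 1 remains a linear factor. *)
Lemma powR_ge_entropy p u : 1 < p -> 0 <= u ->
  u + 2 * (p - 1) * (u - Num.sqrt u) <= u `^ p.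
Proof.
move=> p1; have p0 : 0 < p by lra.
rewrite le_eqVlt => /predU1P[<-|u0].
  by rewrite sqrtr0 powR0 ?gt_eqF ?subrr ?mulr0 ?addr0.
have su : 0 < Num.sqrt u by rewrite sqrtr_gt0.
have suE : Num.sqrt u * Num.sqrt u = u by rewrite -expr2 sqr_sqrtr ?ltW.
have lnu : 2 * (1 - (Num.sqrt u)^-1) <= ln u.
  rewrite -[in leRHS]suE lnM ?posrE//.
  have : ln (1 + ((Num.sqrt u)^-1 - 1)) <= (Num.sqrt u)^-1 - 1.
    apply: le_ln1Dx; have : 0 < (Num.sqrt u)^-1 by rewrite invr_gt0.
    lra.
  by rewrite subrKC lnV ?posrE//; lra.
have : 1 + (p - 1) * ln u <= u `^ (p - 1).
  by rewrite /powR gt_eqF//; exact: expR_ge1Dx.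
rewrite -(mulr_powRB1 (ltW u0) p0).
move=> /(ler_wpM2l (ltW u0)); apply: le_trans.
have E : u * (Num.sqrt u)^-1 = Num.sqrt u by rewrite -{1}suE mulfK ?gt_eqF.
have p1' : 0 <= p - 1 by lra.
have := ler_wpM2l p1' (ler_wpM2l (ltW u0) lnu).
by move: E; set r := (Num.sqrt u)^-1 => <-; lra.
Qed.

Lemma sqrt_1DB_le s : 0 <= s <= 1 -> Num.sqrt (1 + s) + Num.sqrt (1 - s) <= 2 - s ^+ 2 / 4.
Proof.
move=> /andP[s0 s1].
set x := Num.sqrt (1 + s); set y := Num.sqrt (1 - s).
have x0 : 0 <= x by rewrite sqrtr_ge0.
have y0 : 0 <= y by rewrite sqrtr_ge0.
have xx : x ^+ 2 = 1 + s by rewrite sqr_sqrtr//; lra.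
have yy : y ^+ 2 = 1 - s by rewrite sqr_sqrtr//; lra.
have xy : (x * y) ^+ 2 = 1 - s ^+ 2 by rewrite exprMn xx yy; ring.
have z0 : 0 <= x * y by rewrite mulr_ge0.
have xyle : x * y <= 1 - s ^+ 2 / 2.
  have s2 : s ^+ 2 <= 1 by rewrite expr_le1.
  have rhs0 : 0 <= 1 - s ^+ 2 / 2 by lra.
  rewrite -(@ler_pXn2r _ 2) ?nnegrE// xy.
  by have := sqr_ge0 (s ^+ 2); nra.
have s2 : s ^+ 2 <= 1 by rewrite expr_le1.
have rhs0 : 0 <= 2 - s ^+ 2 / 4 by lra.
have xy0 : 0 <= x + y by exact: addr_ge0.
rewrite -(@ler_pXn2r _ 2) ?nnegrE//.
have -> : (x + y) ^+ 2 = x ^+ 2 + y ^+ 2 + 2 * (x * y) by ring.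
by rewrite xx yy; nra.
Qed.

(** [powR_ge_entropy] at 1 + s and 1 - s yields the gain (p - 1) (2 - sqrt(1 + s) - sqrt(1 - s)),
    which [sqrt_1DB_le] bounds below. *)
Lemma powR_two_point p s : 1 < p -> 0 <= s <= 1 ->
  1 + (p - 1) / 4 * s ^+ 2 <= 2^-1 * ((1 + s) `^ p + (1 - s) `^ p).
Proof.
move=> p1 s01; have := sqrt_1DB_le s01; case/andP: s01 => s0 s1.
have := @powR_ge_entropy p (1 + s) p1 (addr_ge0 ler01 s0).
have := @powR_ge_entropy p (1 - s) p1; rewrite subr_ge0 => /(_ s1).
set x := Num.sqrt _; set y := Num.sqrt _; set a := _ `^ _; set b := _ `^ _.
nra.
Qed.

(** By homogeneity this reduces to d = M s with 0 <= s <= 1. There s^q <= s^2, and the mean is at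
    least 1, so the power q/p >= 1 can only increase it. *)
Lemma powR_mean_ge p q M d : 1 < p -> 2 <= q -> p <= q -> 0 <= d -> d <= M ->
  M `^ q + (p - 1) / 4 * d `^ q <=
  (2^-1 * ((M + d) `^ p + (M - d) `^ p)) `^ (q / p).
Proof.
move=> p1 q2 pq d0 dM.
have p0 : 0 < p by lra.
have q0 : 0 < q by lra.
have [M0|M0] := eqVneq M 0.
  have -> : d = 0 by lra.
  by rewrite M0 powR0 ?gt_eqF// mulr0 addr0 powR_ge0.
have {}M0 : 0 < M by lra.
have [s s01 ->] : exists2 s, 0 <= s <= 1 & d = M * s.
  exists (d / M); last by rewrite mulrC divfK ?gt_eqF.
  by rewrite divr_ge0 ?(ltW M0)//= ler_pdivrMr// mul1r.
have /andP[s0 s1] := s01.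
have -> : M + M * s = M * (1 + s) by ring.
have -> : M - M * s = M * (1 - s) by ring.
have h1 : 0 <= 1 + s by lra.
have h2 : 0 <= 1 - s by lra.
have PM c r : 0 <= c -> (M * c) `^ r = M `^ r * c `^ r by move=> c0; rewrite powRM// ltW.
rewrite !PM// -[M `^ p * _ + _]mulrDr [2^-1 * (_ * _)]mulrCA.
rewrite powRM ?powR_ge0 ?mulr_ge0 ?invr_ge0 ?addr_ge0 ?powR_ge0// -powRrM.
rewrite [p * _]mulrC divfK ?gt_eqF//.
rewrite -[X in X + _]mulr1 mulrCA -mulrDr ler_pM2l ?powR_gt0//.
have c0 : 0 <= (p - 1) / 4 by rewrite divr_ge0//; lra.
apply: (@le_trans _ _ (1 + (p - 1) / 4 * s ^+ 2)).
  rewrite lerD2l ler_wpM2l//; have [->|sn0] := eqVneq s 0.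
    by rewrite powR0 ?expr0n ?gt_eqF.
  rewrite -powR_mulrn//; apply: ger_powR => //.
  by rewrite lt_neqAle eq_sym sn0 s0.
have := powR_two_point p1 s01; move=> Hle; apply: (le_trans Hle).
apply: le1r_powR; last by rewrite ler_pdivlMr// mul1r.
by apply: le_trans Hle; rewrite lerDl mulr_ge0// sqr_ge0.
Qed.

Lemma powR_superadditive r u v : 1 <= r -> 0 <= u -> 0 <= v ->
  u `^ r + v `^ r <= (u + v) `^ r.
Proof.
move=> r1 u0 v0; have r0 : r != 0 by rewrite gt_eqF//; lra.
have [->|un] := eqVneq u 0; first by rewrite powR0// !add0r.
have uv0 : 0 < u + v by rewrite ltr_wpDr// lt_neqAle eq_sym un.
have H x : 0 <= x -> x <= u + v -> x `^ r <= (u + v) `^ r * (x / (u + v)).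
  move=> x0 xle; have [->|xn] := eqVneq x 0.
    by rewrite powR0// mul0r mulr0.
  have {1}-> : x = (u + v) * (x / (u + v)) by rewrite mulrC divfK ?gt_eqF.
  rewrite powRM; [|exact: ltW|by rewrite divr_ge0// ltW].
  rewrite ler_pM2l ?powR_gt0//.
  apply: ge1r_powR => //; rewrite divr_gt0 ?ler_pdivrMr ?mul1r//.
  by rewrite lt_neqAle eq_sym xn.
have /(H _ u0) Hu : u <= u + v by lra.
have /(H _ v0) Hv : v <= u + v by lra.
apply: le_trans (lerD Hu Hv) _.
by rewrite -mulrDr -mulrDl mulfV ?gt_eqF// mulr1.
Qed.

Variable E : normedModType R.
Implicit Types x y : E.

Definition uniformly_convex_with q K := forall x y : E,
  `|x| `^ q + K `^ (- q) * `|y| `^ q <=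
  2^-1 * `|x + y| `^ q + 2^-1 * `|x - y| `^ q.

(** Let M and d be the half sum and half difference of |x + y| and |x - y|. If |y| <= 2 d, the
    scalar gain in d^q of [powR_mean_ge] controls y. Otherwise |x + y| and |x - y| are comparable,
    and convexity of E at the two normalized vectors pushes |x| below M by enough to control y. *)
Lemma two_point_lt p q K kappa x y : 1 < p -> 2 <= q -> p <= q -> 0 < K ->
  uniformly_convex_with q K ->
  0 <= kappa -> kappa * 2 `^ q <= (p - 1) / 4 -> kappa * 2 `^ q <= 2^-1 * K `^ (- q) ->
  `|x| `^ q + kappa * `|y| `^ q <=
  (2^-1 * (`|x + y| `^ p + `|x - y| `^ p)) `^ (q / p).
Proof.
move=> p1 q2 pq K0 ucK kappa0 kappa1 kappa2.
wlog : y / `|x - y| <= `|x + y|.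
  move=> wl; have [le_xy|lt_xy] := leP `|x - y| `|x + y|; first exact: wl.
  have := wl (- y); rewrite opprK normrN [X in 2^-1 * X]addrC.
  by apply; exact: ltW.
move=> le_xy.
set M := 2^-1 * (`|x + y| + `|x - y|); set d := 2^-1 * (`|x + y| - `|x - y|).
have nxy1 : `|x + y| = M + d by rewrite /M /d; field.
have nxy2 : `|x - y| = M - d by rewrite /M /d; field.
have d0 : 0 <= d by rewrite mulr_ge0 ?invr_ge0 ?subr_ge0.
have dM : d <= M by rewrite -subr_ge0 -nxy2.
have M0 : 0 <= M by lra.
have q0 : 0 <= q by lra.
have q1 : 1 <= q by lra.
have nx : `|x| <= M.
  have := ler_normD (x + y) (x - y); rewrite addrACA subrr addr0 -mulr2n normrMn.
  by rewrite nxy1 nxy2 -mulr_natl; lra.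
have ny : `|y| <= M.
  have := ler_normB (x + y) (x - y); rewrite opprB addrC addrA subrK -mulr2n normrMn.
  by rewrite nxy1 nxy2 -mulr_natl; lra.
rewrite nxy1 nxy2; apply: le_trans (powR_mean_ge p1 q2 pq d0 dM).
have [yd|dy] := leP `|y| (2 * d).
  apply: lerD; first exact: ler_powR2r.
  have yq : `|y| `^ q <= 2 `^ q * d `^ q by rewrite -powRM// ler_powR2r.
  apply: le_trans (ler_wpM2l kappa0 yq) _.
  by rewrite mulrA ler_wpM2r// powR_ge0.
(* Here 2 d < |y| <= M, and the term M^q suffices. *)
apply: (@le_trans _ _ (M `^ q)); last first.
  by rewrite lerDl mulr_ge0 ?powR_ge0// divr_ge0//; lra.
have Md : 0 < M - d by lra.
have {}M0 : 0 < M by lra.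
have Md' : 0 < M + d by lra.
have unit_vec c (z : E) : 0 < c -> `|z| = c -> exists2 u : E, `|u| = 1 & z = c *: u.
  move=> c0 zc; exists (c^-1 *: z); last by rewrite scalerA mulfV ?scale1r// gt_eqF.
  by rewrite normrZ zc ger0_norm ?invr_ge0 ?mulVf ?gt_eqF// ltW.
have [u nu xyu] := unit_vec _ _ Md' nxy1.
have [v nv xyv] := unit_vec _ _ Md nxy2.
have hd (a b : E) : 2^-1 *: (a + b) + 2^-1 *: (a - b) = a.
  rewrite -scalerDr addrACA subrr addr0 scalerDr -scalerDl.
  by rewrite (_ : 2^-1 + 2^-1 = 1) ?scale1r//; field.
have hd' (a b : E) : 2^-1 *: (a + b) - 2^-1 *: (a - b) = b.
  rewrite -scalerBr opprB [_ + (b - a)]addrC addrA subrK scalerDr -scalerDl.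
  by rewrite (_ : 2^-1 + 2^-1 = 1) ?scale1r//; field.
(* Half sum and half difference of unit vectors, so [ucK] gives |w|^q + K^(-q) |e|^q <= 1. *)
pose w := 2^-1 *: (u + v); pose e := 2^-1 *: (u - v).
have := ucK w e; rewrite hd hd' nu nv powR1 -mulrDl.
rewrite (_ : 2^-1 + 2^-1 = 1) ?mul1r; last by field.
move=> uc.
have xE : x = d *: u + (M - d) *: w.
  rewrite -[LHS](hd x y) xyu xyv /w !scalerDr !scalerA addrA -scalerDl.
  by congr (_ *: _ + _ *: _); field.
have yE : y = d *: w + M *: e.
  rewrite -[LHS](hd' x y) xyu xyv /w /e !scalerDr !scalerN !scalerA.
  rewrite [RHS]addrACA -scalerDl -scalerBl -scaleNr.
  by congr (_ *: _ + _ *: _); field.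
have Kq0 : 0 <= K `^ (- q) by rewrite powR_ge0.
have nw : `|w| <= 1.
  rewrite normrZ ger0_norm ?invr_ge0//; have := ler_normD u v; rewrite nu nv; lra.
clearbody w e.
have nx' : `|x| <= M * (d / M * 1 + (1 - d / M) * `|w|).
  have -> : M * (d / M * 1 + (1 - d / M) * `|w|) = d + (M - d) * `|w|.
    by field; rewrite gt_eqF.
  rewrite {1}xE; apply: le_trans (ler_normD _ _) _.
  have -> : `|d *: u| = d by rewrite normrZ nu mulr1 ger0_norm.
  by rewrite normrZ [`|M - d|]ger0_norm// ltW.
have dM01 : 0 <= d / M <= 1 by rewrite divr_ge0 ?(ltW M0)//= ler_pdivrMr// mul1r.
have /andP[dM0 dM1] := dM01.
have dM2 : d / M <= 2^-1 by rewrite ler_pdivrMr//; lra.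
(* Since d / M <= 1/2, the weight 1 - d / M of w retains at least half of its deficit. *)
have xq : `|x| `^ q <= M `^ q * (1 - 2^-1 * K `^ (- q) * `|e| `^ q).
  apply: le_trans (ler_powR2r q0 (normr_ge0 x) nx') _.
  have c0 : 0 <= d / M * 1 + (1 - d / M) * `|w|.
    by rewrite mulr1 addr_ge0// mulr_ge0// subr_ge0.
  rewrite powRM ?(ltW M0)//.
  rewrite ler_pM2l ?powR_gt0//.
  apply: le_trans (powR_convex q1 dM01 ler01 (normr_ge0 w)) _.
  rewrite powR1.
  have Ke : 0 <= K `^ (- q) * `|e| `^ q by rewrite mulr_ge0// powR_ge0.
  move: uc Ke; rewrite -mulrA; set Z := K `^ _ * _; set W := `|w| `^ q.
  have W0 : 0 <= W by exact: powR_ge0.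
  move: dM0 dM2; set t := d / M; nra.
(* |y| <= d + M |e|, and d < |y| / 2 is absorbed. *)
have ye : `|y| <= 2 * (M * `|e|).
  have : `|y| <= d * `|w| + M * `|e|.
    have -> : d * `|w| = `|d *: w| by rewrite normrZ ger0_norm.
    have -> : M * `|e| = `|M *: e| by rewrite normrZ ger0_norm// ltW.
    by rewrite {1}yE ler_normD.
  have : d * `|w| <= d by rewrite ler_piMr.
  lra.
have yq : `|y| `^ q <= 2 `^ q * (M `^ q * `|e| `^ q).
  by rewrite -!powRM ?mulr_ge0 ?(ltW M0)// ler_powR2r.
have : kappa * `|y| `^ q <= 2^-1 * K `^ (- q) * (M `^ q * `|e| `^ q).
  apply: le_trans (ler_wpM2l kappa0 yq) _.
  by rewrite [leLHS]mulrA ler_wpM2r// mulr_ge0 ?powR_ge0.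
by move: xq; rewrite mulrBr mulr1; lra.
Qed.

(** Raise the q-convexity of E to the power p/q >= 1: Jensen on the right, superadditivity on the
    left, and K^(-q) becomes K^(-p). *)
Lemma two_point_ge p q K kappa x y : 2 <= q -> q <= p -> 0 < K ->
  uniformly_convex_with q K -> 0 <= kappa -> kappa <= K `^ (- p) ->
  `|x| `^ p + kappa * `|y| `^ p <= 2^-1 * (`|x + y| `^ p + `|x - y| `^ p).
Proof.
move=> q2 qp K0 ucK kappa0 kappaK.
have q0 : 0 < q by lra.
have r1 : 1 <= p / q by rewrite ler_pdivlMr// mul1r.
have pE (z : R) : z `^ p = (z `^ q) `^ (p / q).
  by rewrite -powRrM mulrC divfK ?gt_eqF.
have -> : 2^-1 * (`|x + y| `^ p + `|x - y| `^ p) =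
    2^-1 * `|x + y| `^ p + (1 - 2^-1) * `|x - y| `^ p by field.
rewrite (pE `|x + y|) (pE `|x - y|).
have h01 : 0 <= (2^-1 : R) <= 1 by lra.
apply: le_trans (powR_convex r1 h01 (powR_ge0 _ _) (powR_ge0 _ _)).
rewrite (_ : 1 - 2^-1 = 2^-1); last by field.
apply: le_trans (ler_powR2r _ _ (ucK x y)); last 2 first.
- lra.
- by rewrite addr_ge0 ?mulr_ge0 ?powR_ge0.
apply: le_trans (powR_superadditive r1 (powR_ge0 _ _) _); last first.
  by rewrite mulr_ge0 ?powR_ge0.
rewrite powRM ?powR_ge0// -!pE lerD2l ler_wpM2r ?powR_ge0//.
by rewrite -powRrM mulNr mulrC divfK ?gt_eqF.
Qed.

(** The slack in K <= 2 X allows for an infimum that need not be attained. For p < q the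
    requirements of [two_point_lt] concern (8 X)^(-q) 2^q = (4 X)^(-q): 4^q >= 4 serves the one on
    (p - 1) / 4, and (4 X)^q = 2^q (2 X)^q >= 2 K^q the one on K^(-q) / 2. *)
Lemma two_point p q K X x y (m := Num.max p q) : 1 < p -> 2 <= q -> 0 < K ->
  uniformly_convex_with q K -> 1 <= X -> K <= 2 * X -> (p - 1) `^ (q^-1 - 1) <= X ->
  `|x| `^ m + (8 * X) `^ (- m) * `|y| `^ m <=
  (2^-1 * (`|x + y| `^ p + `|x - y| `^ p)) `^ (m / p).
Proof.
move=> p1 q2 K0 ucK X1 KX pX; have X0 : 0 < X by lra.
have p0 : 0 < p by lra.
rewrite /m; have [qp|pq] := leP q p.
  rewrite mulfV ?gt_eqF// powRr1; last by rewrite mulr_ge0 ?addr_ge0 ?powR_ge0.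
  apply: (two_point_ge x y q2 qp K0 ucK); first exact: powR_ge0.
  by rewrite !powRN lef_pV2 ?posrE ?powR_gt0 ?mulr_gt0// ler_powR2r ?ltW//; lra.
have q0 : 0 < q by lra.
have q1 : 1 <= q by lra.
(* For p <= 2, X^q >= (p - 1)^(1 - q) with 1 - q <= -1 and p - 1 <= 1; for p > 2 the left side is
   below 1. *)
have Xq : (p - 1)^-1 <= X `^ q.
  have [p2|p2] := leP p 2.
    have := ler_powR2r (ltW q0) (powR_ge0 _ _) pX; apply: le_trans.
    rewrite -powRrM mulrBl mulVf ?gt_eqF// mul1r -powR_inv1; last lra.
    by apply: ger_powR; lra.
  apply: (@le_trans _ _ 1); first by rewrite invf_le1; lra.
  exact: le_trans X1 (le1r_powR X1 q1).
have c4 : 4 <= 4 `^ q :> R by rewrite le1r_powR//; lra.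
have c2 : 2 <= 2 `^ q :> R by rewrite le1r_powR//; lra.
have Xq0 : 0 < X `^ q by rewrite powR_gt0.
have EX : (8 * X) `^ (- q) * 2 `^ q = (4 `^ q * X `^ q)^-1.
  rewrite powRN -powRM ?(ltW X0)// (_ : 8 * X = 2 * (4 * X)); last by ring.
  rewrite [in LHS]powRM; [|lra|lra].
  by rewrite invfM mulrC mulrA mulfV ?gt_eqF ?powR_gt0// mul1r.
apply: (two_point_lt x y p1 q2 (ltW pq) K0 ucK); first exact: powR_ge0.
  rewrite EX invf_ple ?posrE ?divr_gt0 ?mulr_gt0 ?powR_gt0//; [|lra].
  by rewrite invf_div; apply: ler_pM => //; rewrite invr_ge0; lra.
rewrite EX powRN -invfM lef_pV2 ?posrE ?mulr_gt0 ?powR_gt0//.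
apply: (@le_trans _ _ (2 `^ q * (2 * X) `^ q)).
  by apply: ler_pM => //; [exact: powR_ge0|exact: ler_powR2r (ltW q0) (ltW K0) KX].
rewrite powRM ?(ltW X0)// mulrA -powRM// (_ : 2 * 2 = 4 :> R)//; ring.
Qed.

End TwoPoint.

(** * Integration on R^3 *)

Section ContinuousIntegration.
Variable R : realType.
Local Notation T3 := ((R * R) * R)%type.
Local Notation mu := (@lebesgue_measure R).
Local Notation vol := (leb3 R).

(** R^3 carries the product sigma-algebra, which contains every open set because such a set is a
    countable union of rational cubes. *)
Lemma continuous_measurable_R3 (g : T3 -> R) : continuous g -> measurable_fun [set: T3] g.
Proof.
move=> cg; apply: (measurability _ (RGenOInfty.measurableE R)) => //.
move=> _ [_ [a ->] <-]; rewrite setTI.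
set U := g @^-1` _.
have oU : open U by apply: open_comp; [move=> + _; exact: cg|exact: interval_open].
pose box (i : rat * rat * rat * rat) : set T3 :=
  (ball (ratr i.1.1.1 : R) (ratr i.2) `*` ball (ratr i.1.1.2 : R) (ratr i.2)) `*`
   ball (ratr i.1.2 : R) (ratr i.2).
pose F i := if `[< box i `<=` U >] then box i else set0.
have -> : U = \bigcup_i F i.
  apply/seteqP; split=> [[[x y] z] Uh|h [i _]]; last first.
    by rewrite /F; case: asboolP => // + Bh; exact.
  have [e /= e0 He] : exists2 e : R, 0 < e & ball ((x, y), z) e `<=` U.
    by move: oU; rewrite openE => /(_ _ Uh); rewrite /interior -nbhs_ballE => -[e e0 He]; exists e.
  have [r /[!in_itv]/= /andP[r0 re]] := @rat_in_itvoo R 0 (e / 2) (divr_gt0 e0 (ltr0Sn _ _)).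
  have near_rat (t : R) : exists c : rat, ball (ratr c : R) (ratr r) t.
    have [|c /[!in_itv]/= /andP[c1 c2]] := @rat_in_itvoo R (t - ratr r) (t + ratr r).
      by lra.
    by exists c; rewrite /ball/= ltr_distl; lra.
  have [cx Hx] := near_rat x; have [cy Hy] := near_rat y; have [cz Hz] := near_rat z.
  exists (cx, cy, cz, r) => //; rewrite /F; case: asboolP => // -[].
  move=> [[x' y'] z'] [[/= Bx By] Bz]; apply: He.
  have tri (c t t' : R) : ball c (ratr r) t -> ball c (ratr r) t' -> ball t e t'.
    move=> Ht Ht'; apply: le_ball (ball_triangle (ball_sym Ht) Ht'); lra.
  by split; [split|]; [exact: tri Hx Bx|exact: tri Hy By|exact: tri Hz Bz].
apply: countable_bigcupT_measurable => [|i]; first exact: countableP.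
rewrite /F; case: asboolP => // _.
by apply: measurableX; [apply: measurableX|]; exact: measurable_ball.
Qed.

Lemma ge0_integral_translate (f : R -> \bar R) (a : R) :
  measurable_fun [set: R] f -> (forall x, 0 <= f x)%E ->
  (\int[mu]_x f (x + a)%R = \int[mu]_x f x)%E.
Proof.
move=> mf f0.
have madd : measurable_fun [set: measurableTypeR R]
    ((fun x : R => x + a) : measurableTypeR R -> measurableTypeR R).
  by apply: measurable_funD => //; exact: measurable_cst.
have := @ge0_integral_pushforward _ _ (measurableTypeR R) (measurableTypeR R) R
  (fun x : R => x + a) madd mu setT f measurableT mf (fun x _ => f0 x).
rewrite preimage_setT /= => <-.
apply: eq_measure_integral => //= A mA _.
apply/esym/lebesgue_measure_unique => //= _ [[b c]] _ <-.
rewrite /pushforward.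
have -> : (fun x : R => x + a) @^-1` `]b, c] = `]b - a, c - a]%classic.
  by apply/seteqP; split => x /=; rewrite !in_itv/= ltrBlDr lerBrDr.
rewrite !lebesgue_measure_itv/= !lte_fin ltrD2r.
by case: ifP => // _; rewrite -!EFinB; congr (_%:E); ring.
Qed.

(* The library equips [product_measure1] with a sigma-finite structure only for
   subprobabilities, hence the alias. *)
Definition lebesgue2 : set (measurableTypeR R * measurableTypeR R)%type -> \bar R :=
  (mu \x mu)%E.

HB.instance Definition _ := Measure.on lebesgue2.

Lemma sigma_finite_lebesgue2 : sigma_finite setT lebesgue2.
Proof.
have /sigma_finiteP[F [TF ndF Foo]] := sigma_finiteT mu.
exists (fun n => F n `*` F n).
  rewrite -setXTT {1 2}TF predeqE => -[x y]; split => [[/= [n _ Fnx] [k _ Gky]]|].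
    by exists (maxn n k) => //; split;
      [move: x Fnx|move: y Gky]; apply/subsetPset/ndF; rewrite ?leq_maxl ?leq_maxr.
  by move=> [n _ []/= ? ?]; split; exists n.
move=> k; have [? ?] := Foo k; split; first exact: measurableX.
by rewrite /lebesgue2 product_measure1E// lte_mul_pinfty// ge0_fin_numE.
Qed.

HB.instance Definition _ :=
  Measure_isSigmaFinite.Build _ _ _ lebesgue2 sigma_finite_lebesgue2.

Lemma ge0_integral_R3 (F : T3 -> \bar R) :
  measurable_fun [set: T3] F -> (forall h, 0 <= F h)%E ->
  (\int[vol]_h F h = \int[mu \x mu]_w \int[mu]_z F (w, z))%E.
Proof.
by move=> mF F0; exact: (@fubini_tonelli1 _ _ _ (measurableTypeR R) R lebesgue2 mu F mF F0).
Qed.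

Lemma ge0_integral_R2 (F : R * R -> \bar R) :
  measurable_fun [set: R * R] F -> (forall h, 0 <= F h)%E ->
  (\int[mu \x mu]_w F w = \int[mu]_x \int[mu]_y F (x, y))%E.
Proof.
move=> mF F0.
exact: (@fubini_tonelli1 _ _ (measurableTypeR R) (measurableTypeR R) R mu mu F mF F0).
Qed.

(** By Tonelli: at fixed [h.1] the vertical shift is a constant translation, and undoing it leaves
    translations of the two horizontal variables. *)
Lemma ge0_integral_shear (G : T3 -> \bar R) (a b : R) (k : R * R -> R) :
  measurable_fun [set: R * R] k -> measurable_fun [set: T3] G -> (forall h, 0 <= G h)%E ->
  (\int[vol]_h G ((h.1.1 + a, h.1.2 + b), h.2 + k h.1)%R = \int[vol]_h G h)%E.
Proof.
move=> mk mG G0.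
have m1 : measurable_fun [set: R * R] (fun w : R * R => (w.1 + a, w.2 + b) : R * R).
  apply: measurable_fun_pair; apply: measurable_funD => //; exact: measurable_cst.
have m3 : measurable_fun [set: T3]
    (fun h : T3 => ((h.1.1 + a, h.1.2 + b), h.2 + k h.1) : T3).
  apply: measurable_fun_pair; first exact: measurableT_comp m1 measurable_fst.
  apply: measurable_funD; first exact: measurable_snd.
  exact: measurableT_comp mk measurable_fst.
have mGp := measurableT_comp mG m3.
rewrite [RHS](ge0_integral_R3 mG)//.
transitivity (\int[mu \x mu]_w \int[mu]_z G ((w.1 + a, w.2 + b), z + k w)%R)%E.
  exact: (ge0_integral_R3 mGp (fun=> G0 _)).
pose H w := (\int[mu]_z G (w, z))%E.
have mH : measurable_fun [set: R * R] H by apply: (measurable_fun_fubini_tonelli_F (m2 := mu) G).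
have H0 w : (0 <= H w)%E by apply: integral_ge0 => *; exact: G0.
transitivity (\int[mu \x mu]_w H (w.1 + a, w.2 + b)%R)%E.
  apply: eq_integral => w _.
  apply: (ge0_integral_translate (f := fun z => G ((w.1 + a, w.2 + b), z))) => [|z]; last exact: G0.
  exact: measurableT_comp mG (measurable_pair1 _).
have mHp := measurableT_comp mH m1.
rewrite [RHS](ge0_integral_R2 mH)//.
transitivity (\int[mu]_x \int[mu]_y H (x + a, y + b)%R)%E; first exact: (ge0_integral_R2 mHp (fun=> H0 _)).
pose L x := (\int[mu]_y H (x, y))%E.
have mL : measurable_fun [set: R] L by apply: (measurable_fun_fubini_tonelli_F (m2 := mu) H).
have L0 x : (0 <= L x)%E by apply: integral_ge0 => *; exact: H0.
transitivity (\int[mu]_x L (x + a)%R)%E; last exact: ge0_integral_translate.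
apply: eq_integral => x _.
apply: (ge0_integral_translate (f := fun y => H (x + a, y))) => [|y]; last exact: H0.
exact: measurableT_comp mH (measurable_pair1 _).
Qed.

Definition cube (r : R) : set T3 := (`[- r, r] `*` `[- r, r]) `*` `[- r, r].

Lemma measurable_cube r : measurable (cube r).
Proof. by apply: measurableX => //; apply: measurableX. Qed.

Lemma cubeE r h : cube r h <-> [/\ `|h.1.1| <= r, `|h.1.2| <= r & `|h.2| <= r].
Proof.
rewrite /cube /= !in_itv/= -!ler_norml; split; first by move=> [[]].
by move=> [-> -> ->].
Qed.

Lemma compact_cube r : compact (cube r).
Proof. by apply: compact_setX; [apply: compact_setX|]; exact: segment_compact. Qed.

Lemma vol_cube r : 0 <= r -> vol (cube r) = ((2 * r) ^+ 3)%:E.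
Proof.
move=> r0; rewrite /cube.
have muI : mu `[- r, r]%classic = (2 * r)%:E.
  rewrite lebesgue_measure_itv/= lte_fin.
  case: ifPn => [_|]; first by rewrite -EFinB; congr (_%:E); ring.
  by rewrite -leNgt => rr; congr (_%:E); lra.
set I := `[- r, r]%classic in muI *.
have mI : measurable I by exact: measurable_itv.
transitivity ((mu \x mu)%E (I `*` I) * mu I)%E.
  by apply: product_measure1E => //; exact: measurableX.
have -> : (mu \x mu)%E (I `*` I) = (mu I * mu I)%E by exact: product_measure1E.
by rewrite muI -!EFinM; congr (_%:E); ring.
Qed.

End ContinuousIntegration.

(** * The L_p norm of compactly supported functions *)

Section CompactlySupported.
Variables (R : realType) (E : normedModType R).
Local Notation T3 := ((R * R) * R)%type.
Local Notation vol := (leb3 R).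

(** Continuous compactly supported functions stand in for L_p(R^3; E). They include f, Xf and Yf,
    are stable under the flows and have finite L_p norm, and only the scalar functions |u|^p get
    integrated. *)
Definition cc_pred : {pred T3 -> E} := fun u => `[< continuous u /\ compact_support u >].

Lemma cc_predP (u : T3 -> E) : reflect (continuous u /\ compact_support u) (u \in cc_pred).
Proof. exact: asboolP. Qed.

Lemma compact_supportP (u : T3 -> E) : compact_support u ->
  exists2 r : R, 0 <= r & forall h, ~ cube r h -> u h = 0.
Proof.
move=> [r Hr]; exists `|r|; first exact: normr_ge0.
move=> h /cubeE Hh; apply: Hr.
have [h1|h1] := ltP r `|h.1.1|; first by left.
have [h2|h2] := ltP r `|h.1.2|; first by right; left.
have [h3|h3] := ltP r `|h.2|; first by right; right.
by case: Hh; split; apply: le_trans (ler_norm r).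
Qed.

Lemma compact_support_cube (u : T3 -> E) r :
  (forall h, ~ cube r h -> u h = 0) -> compact_support u.
Proof.
move=> Hr; exists r => h Hh; apply: Hr => /cubeE[h1 h2 h3].
by case: Hh => [|[]]; rewrite ltNge ?h1 ?h2 ?h3.
Qed.

Lemma subset_cube (r s : R) h : r <= s -> cube r h -> cube s h.
Proof. by move=> rs /cubeE[h1 h2 h3]; apply/cubeE; split; exact: le_trans rs. Qed.

Lemma cc_submod_closed : GRing.submod_closed cc_pred.
Proof.
split.
  apply/cc_predP; split; first by move=> h; exact: cvg_cst.
  by exists 0.
move=> a u v /cc_predP[cu /compact_supportP[r r0 su]] /cc_predP[cv /compact_supportP[s s0 sv]].
apply/cc_predP; split.
  by move=> h; apply: cvgD; [apply: cvgZr; exact: cu|exact: cv].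
apply: (@compact_support_cube _ (Num.max r s)) => h Hh.
have -> : (a *: u + v) h = a *: u h + v h by [].
rewrite su ?sv ?scaler0 ?addr0// => Hc; apply: Hh; apply: subset_cube Hc.
  by rewrite le_max lexx orbT.
by rewrite le_max lexx.
Qed.

HB.instance Definition _ := GRing.isSubmodClosed.Build _ _ cc_pred cc_submod_closed.

Record ccfun := CCFun { ccfun_val :> T3 -> E ; _ : ccfun_val \in cc_pred }.

HB.instance Definition _ := [isSub for ccfun_val].
HB.instance Definition _ := [Choice of ccfun by <:].
HB.instance Definition _ := [SubChoice_isSubLmodule of ccfun by <:].

Lemma ccfunP (u : ccfun) : continuous u /\ compact_support u.
Proof. by apply/cc_predP; case: u. Qed.

Lemma ccfun_ext (u v : ccfun) : (forall h, u h = v h) -> u = v.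
Proof. by move=> uv; apply: val_inj; apply/funext. Qed.

Lemma ccfunB (u v : ccfun) h : (u - v) h = u h - v h. Proof. by []. Qed.
Lemma ccfunZ a (u : ccfun) h : (a *: u) h = a *: u h. Proof. by []. Qed.

Lemma ccfun_bounded (u : ccfun) : exists M r : R,
  [/\ 0 <= r, forall h, `|u h| <= M & forall h, ~ cube r h -> u h = 0].
Proof.
have [cu /compact_supportP[r r0 su]] := ccfunP u.
have [|||c _ Hc] := @compact_EVT_max _ R (fun h => `|u h|) (cube r).
- by exists 0; apply/cubeE; rewrite /= normr0.
- exact: compact_cube.
- by apply: continuous_subspaceT => h; apply: continuous_comp; [exact: cu|exact: norm_continuous].
exists `|u c|, r; split => // h; have [hr|hr] := pselect (cube r h).
  by apply: Hc; rewrite inE.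
by rewrite su// normr0.
Qed.

Lemma ccfun_uniform (u : ccfun) e : 0 < e ->
  exists2 d : R, 0 < d & forall h h', ball h d h' -> `|u h - u h'| <= e.
Proof.
move=> e0; have [cu /compact_supportP[r r0 su]] := ccfunP u.
have /compact_near_coveringP cov := @compact_cube R (r + 1).
have [|d /= d0 Hd] := cov R (0^'+) (fun d h => forall h', ball h d h' -> `|u h - u h'| <= e) _.
  move=> h0 _.
  have /cvgrPdist_lt/(_ (e / 2) (divr_gt0 e0 (ltr0Sn _ _))) := cu h0.
  rewrite -nbhs_ballE => -[eta /= eta0 Heta].
  exists (ball h0 (eta / 2), [set d | d < eta / 2]) => /=.
    split; first by apply: nbhsx_ballx; rewrite divr_gt0.
    exact/nbhs_right_lt/divr_gt0.
  move=> [h d] /= [Hh dlt] h' Hh'.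
  have half_le : eta / 2 <= eta by lra.
  have H1 := Heta h (le_ball half_le Hh).
  have H2 : `|u h0 - u h'| < e / 2.
    apply: Heta; have := ball_triangle Hh Hh'; apply: le_ball; lra.
  have -> : u h - u h' = (u h0 - u h') - (u h0 - u h).
    by rewrite opprB [_ + (u h - _)]addrC addrA subrK.
  by apply: le_trans (ler_normB _ _) _; lra.
(* A radius at most 1 keeps the ball around a point outside the cube of parameter r + 1 away from
   the support. *)
exists (Num.min (d / 2) 1); first by rewrite lt_min ltr01 divr_gt0.
move=> h h' hh'; have [hr|hr] := pselect (cube (r + 1) h).
  apply: (Hd (Num.min (d / 2) 1)) hh' => //.
  - rewrite /ball/= sub0r normrN ger0_norm ?le_min ?divr_ge0 ?ltW//.
    by rewrite gt_min; apply/orP; left; lra.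
  - by rewrite lt_min ltr01 divr_gt0.
have hle : ball h 1 h' by apply: le_ball hh'; rewrite ge_min lexx orbT.
rewrite !su ?subrr ?normr0 ?ltW// => Hc; apply: hr; last first.
  by apply: subset_cube Hc; lra.
case/cubeE: Hc => h1 h2 h3; case: hle => [[/= b1 b2] b3].
have tri (x y : R) : ball x 1 y -> `|y| <= r -> `|x| <= r + 1.
  rewrite /ball/= => xy yr; have := ler_normD (x - y) y; rewrite subrK; lra.
by apply/cubeE; split; [exact: tri b1 h1|exact: tri b2 h2|exact: tri b3 h3].
Qed.

(** One family contains the flow (x + s, y, z + s y / 2) of X, the flow (x, y + s, z - s x / 2) of Y
    and the vertical translations, so stability of [cc_pred], linearity and invariance of the norm
    are proved once. *)
Definition shear (a b c d e : R) (h : T3) : T3 :=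
  ((h.1.1 + a, h.1.2 + b), h.2 + (c + d * h.1.1 + e * h.1.2)).

Let continuous_fst2 : continuous (fun w : R * R => w.1). Proof. by move=> w; exact: cvg_fst. Qed.
Let continuous_snd2 : continuous (fun w : R * R => w.2). Proof. by move=> w; exact: cvg_snd. Qed.
Let continuous_fst3 : continuous (fun h : T3 => h.1). Proof. by move=> w; exact: cvg_fst. Qed.
Let continuous_snd3 : continuous (fun h : T3 => h.2). Proof. by move=> w; exact: cvg_snd. Qed.

Let continuous_slope (c d e : R) : continuous (fun w : R * R => c + d * w.1 + e * w.2).
Proof.
move=> w; apply: cvgD; first (apply: cvgD; first exact: cvg_cst).
- by apply: cvgMr; exact: continuous_fst2.
- by apply: cvgMr; exact: continuous_snd2.
Qed.

Lemma continuous_shear a b c d e : continuous (shear a b c d e).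
Proof.
have c1 : continuous (fun h : T3 => h.1.1 + a).
  move=> h; apply: cvgD; last exact: cvg_cst.
  by apply: (@continuous_comp _ _ _ (fun h : T3 => h.1) (fun w : R * R => w.1));
    [exact: continuous_fst3|exact: continuous_fst2].
have c2 : continuous (fun h : T3 => h.1.2 + b).
  move=> h; apply: cvgD; last exact: cvg_cst.
  by apply: (@continuous_comp _ _ _ (fun h : T3 => h.1) (fun w : R * R => w.2));
    [exact: continuous_fst3|exact: continuous_snd2].
have c3 : continuous (fun h : T3 => h.2 + (c + d * h.1.1 + e * h.1.2)).
  move=> h; apply: cvgD; first exact: continuous_snd3.
  by apply: (@continuous_comp _ _ _ (fun h : T3 => h.1) (fun w : R * R => c + d * w.1 + e * w.2));
    [exact: continuous_fst3|exact: continuous_slope].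
by move=> h; exact: (cvg_pair (cvg_pair (c1 h) (c2 h)) (c3 h)).
Qed.

Lemma shear_support (u : T3 -> E) a b c d e r : 0 <= r ->
  (forall h, ~ cube r h -> u h = 0) ->
  forall h, ~ cube (r + `|a| + `|b| + (`|c| + `|d| * (r + `|a|) + `|e| * (r + `|b|))) h ->
  u (shear a b c d e h) = 0.
Proof.
move=> r0 su h hs; apply: su => /cubeE[/= h1 h2 h3].
have k0 : 0 <= `|c| + `|d| * (r + `|a|) + `|e| * (r + `|b|).
  by rewrite !addr_ge0 ?mulr_ge0 ?addr_ge0.
have x1 : `|h.1.1| <= r + `|a|.
  by have := ler_normB (h.1.1 + a) a; rewrite addrK; lra.
have x2 : `|h.1.2| <= r + `|b|.
  by have := ler_normB (h.1.2 + b) b; rewrite addrK; lra.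
apply: hs; apply/cubeE; have := normr_ge0 a; have := normr_ge0 b => b0 a0.
split; [lra|lra|].
set k := c + d * h.1.1 + e * h.1.2 in h3.
have kle : `|k| <= `|c| + `|d| * (r + `|a|) + `|e| * (r + `|b|).
  apply: le_trans (ler_normD _ _) _; apply: lerD; last by rewrite normrM ler_wpM2l.
  by apply: le_trans (ler_normD _ _) _; rewrite lerD2l normrM ler_wpM2l.
by have := ler_normB (h.2 + k) k; rewrite addrK; lra.
Qed.

Lemma cc_shear (u : ccfun) a b c d e : u \o shear a b c d e \in cc_pred.
Proof.
have [cu /compact_supportP[r r0 su]] := ccfunP u; apply/cc_predP; split.
  by move=> h; apply: continuous_comp; [exact: continuous_shear|exact: cu].
exact: compact_support_cube (shear_support r0 su).
Qed.

Definition pull a b c d e (u : ccfun) : ccfun := CCFun (cc_shear u a b c d e).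

Lemma pull_linear a b c d e : linear (pull a b c d e).
Proof. by move=> k u v; apply: ccfun_ext. Qed.

HB.instance Definition _ a b c d e :=
  GRing.isLinear.Build R ccfun ccfun *:%R (pull a b c d e) (pull_linear a b c d e).

Section Norm.
Variable p : R.
Hypothesis p1 : 1 < p.
Let p0 : 0 < p. Proof. exact: lt_trans p1. Qed.

Definition pint (u : ccfun) : \bar R := (\int[vol]_h (`|u h| `^ p)%:E)%E.
Lemma pint_def u : pint u = (\int[vol]_h (`|u h| `^ p)%:E)%E.
Proof. by []. Qed.

Definition pmass (u : ccfun) : R := fine (pint u).
Definition pnorm (u : ccfun) : R := pmass u `^ p^-1.

Lemma measurable_pow (u : ccfun) :
  measurable_fun [set: T3] (fun h => (`|u h| `^ p)%:E).
Proof.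
apply/measurable_EFinP.
apply: (measurableT_comp (measurable_powR p)).
apply: continuous_measurable_R3 => h.
by have [cu _] := ccfunP u; apply: continuous_comp; [exact: cu|exact: norm_continuous].
Qed.

Lemma pint_ge0 u : (0 <= pint u)%E.
Proof. by apply: integral_ge0 => h _; rewrite lee_fin powR_ge0. Qed.

Lemma pint_le_cube (u : ccfun) (r M : R) : 0 <= r -> (forall h, `|u h| <= M) ->
  (forall h, ~ cube r h -> u h = 0) -> (pint u <= (M `^ p * (2 * r) ^+ 3)%:E)%E.
Proof.
move=> r0 uM ur.
have -> : pint u = (\int[vol]_(h in cube r) (`|u h| `^ p)%:E)%E.
  rewrite [RHS]integral_mkcond; apply: eq_integral => h _.
  rewrite patchE; case: ifPn => //; rewrite notin_setE => /ur ->.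
  by rewrite normr0 powR0// gt_eqF.
rewrite EFinM -vol_cube// -integral_cst; last exact: measurable_cube.
apply: ge0_le_integral.
- exact: measurable_cube.
- by move=> h _; rewrite lee_fin powR_ge0.
- exact: measurable_funS (measurable_pow u).
- exact: measurable_cst.
- by move=> h _; rewrite lee_fin; apply: ler_powR2r => //; exact: ltW.
Qed.

Lemma pintE u : pint u = (pmass u)%:E.
Proof.
rewrite fineK// ge0_fin_numE ?pint_ge0//.
have [M [r [r0 uM ur]]] := ccfun_bounded u.
exact: le_lt_trans (pint_le_cube r0 uM ur) (ltry _).
Qed.

Lemma pmass_ge0 u : 0 <= pmass u.
Proof. by rewrite -lee_fin -pintE pint_ge0. Qed.

Lemma pmass_le_cube (u : ccfun) (r M : R) : 0 <= r -> (forall h, `|u h| <= M) ->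
  (forall h, ~ cube r h -> u h = 0) -> pmass u <= M `^ p * (2 * r) ^+ 3.
Proof. by move=> r0 uM ur; rewrite -lee_fin -pintE; exact: pint_le_cube. Qed.

Lemma measurable_powZ a (u : ccfun) :
  measurable_fun [set: T3] (fun h => (a * `|u h| `^ p)%:E).
Proof.
under eq_fun do rewrite EFinM.
exact: (measurable_funeM a%:E (measurable_pow u)).
Qed.

Lemma pmassZ (a : R) (u : ccfun) : 0 <= a ->
  (\int[vol]_h (a * `|u h| `^ p)%:E)%E = (a * pmass u)%:E.
Proof.
move=> a0; rewrite EFinM -pintE /pint -ge0_integralZl//.
exact: measurable_pow.
Qed.

Lemma pmass_comb (a b : R) (u v : ccfun) : 0 <= a -> 0 <= b ->
  (\int[vol]_h (a * `|u h| `^ p + b * `|v h| `^ p)%:E)%E =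
  (a * pmass u + b * pmass v)%:E.
Proof.
move=> a0 b0; rewrite EFinD -(pmassZ u a0) -(pmassZ v b0) -ge0_integralD//.
- by move=> h _; rewrite lee_fin mulr_ge0 ?powR_ge0.
- exact: measurable_powZ.
- by move=> h _; rewrite lee_fin mulr_ge0 ?powR_ge0.
- exact: measurable_powZ.
Qed.

Lemma pmassD (u v : ccfun) :
  (\int[vol]_h (`|u h| `^ p + `|v h| `^ p)%:E)%E = (pmass u + pmass v)%:E.
Proof.
by rewrite EFinD -!pintE /pint -ge0_integralD//; exact: measurable_pow.
Qed.

(** The pointwise inequalities integrated below have at most two terms on each side; zero
    coefficients pad the shorter ones. *)
Lemma pmass_comb_le (a b c d : R) (u v w z : ccfun) : 0 <= a -> 0 <= b -> 0 <= c -> 0 <= d ->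
  (forall h, a * `|u h| `^ p + b * `|v h| `^ p <= c * `|w h| `^ p + d * `|z h| `^ p) ->
  a * pmass u + b * pmass v <= c * pmass w + d * pmass z.
Proof.
move=> a0 b0 c0 d0 H; rewrite -lee_fin -(pmass_comb u v a0 b0) -(pmass_comb w z c0 d0).
have mcomb (s t : R) (x y : ccfun) :
    measurable_fun [set: T3] (fun h => (s * `|x h| `^ p + t * `|y h| `^ p)%:E).
  exact: (emeasurable_funD (measurable_powZ s x) (measurable_powZ t y)).
apply: ge0_le_integral.
- exact: measurableT.
- by move=> h _; rewrite lee_fin addr_ge0 ?mulr_ge0 ?powR_ge0.
- exact: mcomb.
- exact: mcomb.
- by move=> h _; rewrite lee_fin; exact: H.
Qed.

Lemma pmass_pull a b c d e u : pmass (pull a b c d e u) = pmass u.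
Proof.
congr fine; apply: (@ge0_integral_shear R (fun h => (`|u h| `^ p)%:E) a b
  (fun w => c + d * w.1 + e * w.2)).
- apply: measurable_funD; first (apply: measurable_funD; first exact: measurable_cst).
    by apply: measurable_funM; [exact: measurable_cst|exact: measurable_fst].
  by apply: measurable_funM; [exact: measurable_cst|exact: measurable_snd].
- exact: measurable_pow.
- by move=> h; rewrite lee_fin powR_ge0.
Qed.

Opaque pmass pint.

Lemma pnorm_ge0 u : 0 <= pnorm u. Proof. exact: powR_ge0. Qed.

Lemma pmassE u : pmass u = pnorm u `^ p.
Proof. by rewrite -powRrM mulVf ?gt_eqF// powRr1// pmass_ge0. Qed.

Lemma pnorm_le u r : 0 <= r -> pmass u <= r `^ p -> pnorm u <= r.
Proof.
move=> r0 /(ler_powR2r _ (pmass_ge0 u)) -/(_ p^-1); rewrite -powRrM mulfV ?gt_eqF//.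
by rewrite powRr1//; apply; rewrite invr_ge0 ltW.
Qed.

Lemma pnorm_pull a b c d e u : pnorm (pull a b c d e u) = pnorm u.
Proof. by rewrite /pnorm pmass_pull. Qed.

Lemma pnormZ a u : pnorm (a *: u) = `|a| * pnorm u.
Proof.
have aa x : `|a *: u x| `^ p = `|a| `^ p * `|u x| `^ p by rewrite normrZ powRM.
have ap : 0 <= `|a| `^ p by exact: powR_ge0.
have -> : pnorm (a *: u) = (`|a| `^ p * pmass u) `^ p^-1.
  congr (_ `^ _); apply/eqP; rewrite eq_le; apply/andP; split.
    have := @pmass_comb_le 1 0 (`|a| `^ p) 0 (a *: u) u u u ler01 (lexx 0) ap (lexx 0).
    rewrite !mul0r !addr0 mul1r; apply => h.
    by rewrite !mul0r !addr0 mul1r aa.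
  have := @pmass_comb_le (`|a| `^ p) 0 1 0 u u (a *: u) u ap (lexx 0) ler01 (lexx 0).
  rewrite !mul0r !addr0 mul1r; apply => h.
  by rewrite !mul0r !addr0 mul1r aa.
by rewrite powRM ?pmass_ge0// -powRrM mulfV ?gt_eqF// powRr1.
Qed.

End Norm.

End CompactlySupported.

Opaque pmass pint pnorm.

(** * Triangle inequality and uniform convexity of the L_p norm *)

Section NormConvexity.
Variables (R : realType) (E : normedModType R) (p : R).
Local Notation ccfun := (ccfun E).
Local Notation pnorm := (@pnorm R E p).
Local Notation pmass := (@pmass R E p).
Implicit Types u v : ccfun.
Hypothesis p1 : 1 < p.
Let p0 : 0 < p. Proof. exact: lt_trans p1. Qed.

Let pmassE (u : ccfun) : pmass u = pnorm u `^ p := pmassE p1 u.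
Let pmass_ge0 (u : ccfun) : 0 <= pmass u := pmass_ge0 p1 u.
Let pmass_comb_le := @pmass_comb_le R E p p1.
Let pnorm_le := @pnorm_le R E p p1.

Let powRV (c s : R) : 0 <= c -> c^-1 `^ s = (c `^ s)^-1.
Proof. by move=> c0; rewrite -(powR_inv1 c0) -powRrM mulN1r powRN. Qed.

(* Convexity of t^p at the convex combination of u / a and v / b of weights
   a / (a + b) and b / (a + b). *)
Let pnormD_le u v a b : 0 < a -> 0 < b -> pnorm u <= a -> pnorm v <= b ->
  pnorm (u + v) <= a + b.
Proof.
move=> a0 b0 ua_le vb_le.
have ab0 : 0 < a + b by rewrite addr_gt0.
apply: pnorm_le; first exact: ltW.
have a'0 : 0 <= a^-1 by rewrite invr_ge0 ltW.
have b'0 : 0 <= b^-1 by rewrite invr_ge0 ltW.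
have [l l_def] : exists l, l = a / (a + b) by eexists.
have l01 : 0 <= l <= 1.
  by rewrite l_def divr_ge0 ?(ltW a0) ?(ltW ab0)//= ler_pdivrMr// mul1r lerDl ltW.
have /andP[l0 l1] := l01.
have lE : 1 - l = b / (a + b) by rewrite l_def; field; rewrite gt_eqF.
have ap : 0 < a `^ p by rewrite powR_gt0.
have bp : 0 < b `^ p by rewrite powR_gt0.
have pt h : 1 * `|(u + v) h| `^ p + 0 * `|u h| `^ p <=
    (a + b) `^ p * (l / a `^ p) * `|u h| `^ p +
    (a + b) `^ p * ((1 - l) / b `^ p) * `|v h| `^ p.
  rewrite mul0r addr0 mul1r.
  have -> : (a + b) `^ p * (l / a `^ p) * `|u h| `^ p =
            (a + b) `^ p * (l * (`|u h| / a) `^ p).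
    by rewrite powRM// powRV ?(ltW a0)//; ring.
  have -> : (a + b) `^ p * ((1 - l) / b `^ p) * `|v h| `^ p =
            (a + b) `^ p * ((1 - l) * (`|v h| / b) `^ p).
    by rewrite powRM// powRV ?(ltW b0)//; ring.
  rewrite -mulrDr.
  have ua : 0 <= `|u h| / a by rewrite divr_ge0// ltW.
  have vb : 0 <= `|v h| / b by rewrite divr_ge0// ltW.
  apply: le_trans (ler_wpM2l (powR_ge0 _ _) (powR_convex (ltW p1) l01 ua vb)).
  rewrite -powRM ?(ltW ab0) ?addr_ge0 ?mulr_ge0 ?subr_ge0//.
  apply: ler_powR2r => //; first exact: ltW.
  have -> : (a + b) * (l * (`|u h| / a) + (1 - l) * (`|v h| / b)) = `|u h| + `|v h|.
    by rewrite lE l_def; field; rewrite !gt_eqF.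
  exact: ler_normD.
have c0 : 0 <= (a + b) `^ p * (l / a `^ p) by rewrite mulr_ge0 ?divr_ge0 ?powR_ge0.
have d0 : 0 <= (a + b) `^ p * ((1 - l) / b `^ p).
  by rewrite mulr_ge0 ?divr_ge0 ?powR_ge0 ?subr_ge0.
have := pmass_comb_le ler01 (lexx 0) c0 d0 pt; rewrite mul1r mul0r addr0.
move/le_trans; apply; rewrite -!mulrA -mulrDr -[leRHS]mulr1 ler_pM2l ?powR_gt0//.
have ua : (a `^ p)^-1 * pmass u <= 1.
  by rewrite mulrC ler_pdivrMr// mul1r pmassE; apply: ler_powR2r ua_le; rewrite ?pnorm_ge0 ?(ltW p0).
have vb : (b `^ p)^-1 * pmass v <= 1.
  by rewrite mulrC ler_pdivrMr// mul1r pmassE; apply: ler_powR2r vb_le; rewrite ?pnorm_ge0 ?(ltW p0).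
have l1' : 0 <= 1 - l by rewrite subr_ge0.
by have := lerD (ler_wpM2l l0 ua) (ler_wpM2l l1' vb); rewrite !mulr1 subrKC.
Qed.

(** [pnormD_le] divides by its bounds, so each norm is enlarged by eps / 2 to make it positive. *)
Lemma pnorm_triangle u v : pnorm (u + v) <= pnorm u + pnorm v.
Proof.
apply/ler_addgt0Pr => eps eps0.
have e0 : 0 < eps / 2 by rewrite divr_gt0.
have -> : pnorm u + pnorm v + eps = (pnorm u + eps / 2) + (pnorm v + eps / 2).
  by rewrite [RHS]addrACA -splitr.
by apply: pnormD_le; rewrite ?lerDl ?(ltW e0)// ltr_wpDl ?pnorm_ge0.
Qed.

Section MeanPmass.
Variables (r k : R).
Hypothesis r1 : 1 <= r.
Hypothesis k0 : 0 <= k.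
Hypothesis pointwise : forall x y : E,
  (`|x| `^ p) `^ r + (k * `|y| `^ p) `^ r <= (2^-1 * (`|x + y| `^ p + `|x - y| `^ p)) `^ r.
Let r0 : 0 < r. Proof. exact: lt_le_trans r1. Qed.

(* The reverse Minkowski inequality in L_p(l_r), by integrating the tangent
   hyperplane of the l_r norm at (A, B). *)
Lemma mean_pmass (u v : ccfun) :
  pmass u `^ r + (k * pmass v) `^ r <= (2^-1 * (pmass (u + v) + pmass (u - v))) `^ r.
Proof.
set A := pmass u; set B := k * pmass v; set W := 2^-1 * _.
have A0 : 0 <= A by exact: pmass_ge0.
have B0 : 0 <= B by exact: mulr_ge0 k0 (pmass_ge0 v).
have W0 : 0 <= W by rewrite mulr_ge0 ?invr_ge0 ?addr_ge0 ?pmass_ge0.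
have r_ne0 : r != 0 by rewrite gt_eqF.
(* Only inequalities linear in the p-th powers of the norms can be integrated; the coefficients a
   and b are chosen afterwards, depending on A and B. *)
have lin a b : 0 <= a -> 0 <= b ->
    (forall x y : E, a * `|x| `^ p + b * (k * `|y| `^ p) <=
                     2^-1 * (`|x + y| `^ p + `|x - y| `^ p)) ->
    a * A + b * B <= W.
  move=> a0 b0 H; rewrite /B /W mulrA mulrDr.
  apply: pmass_comb_le => //; rewrite ?mulr_ge0 ?invr_ge0// => h.
  by rewrite -mulrDr -mulrA; exact: H.
have w0 (x y : E) : 0 <= 2^-1 * (`|x + y| `^ p + `|x - y| `^ p).
  by rewrite mulr_ge0 ?addr_ge0 ?powR_ge0.
have root s t : 0 <= s -> 0 <= t -> s `^ r <= t `^ r -> s <= t.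
  move=> s0 t0 st; rewrite leNgt; apply/negP => ts.
  by have := gt0_ltr_powR r0 t0 s0 ts; rewrite ltNge st.
have [A_eq0|An] := eqVneq A 0.
  rewrite A_eq0 powR0// add0r; apply: ler_powR2r => //; first exact: ltW.
  have := lin 0 1 (lexx _) ler01; rewrite A_eq0 mul0r add0r mul1r; apply => x y.
  rewrite mul0r add0r mul1r; apply: root; rewrite ?mulr_ge0 ?powR_ge0//.
  by apply: le_trans (pointwise x y); rewrite lerDr powR_ge0.
have [B_eq0|Bn] := eqVneq B 0.
  rewrite B_eq0 powR0// addr0; apply: ler_powR2r => //; first exact: ltW.
  have := lin 1 0 ler01 (lexx _); rewrite B_eq0 mul0r addr0 mul1r; apply => x y.
  rewrite mul0r addr0 mul1r; apply: root; rewrite ?powR_ge0//.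
  by apply: le_trans (pointwise x y); rewrite lerDl powR_ge0.
have {}A0 : 0 < A by rewrite lt_neqAle eq_sym An.
have {}B0 : 0 < B by rewrite lt_neqAle eq_sym Bn.
have Ar : 0 < A `^ r by rewrite powR_gt0.
have Br : 0 < B `^ r by rewrite powR_gt0.
have AB0 : 0 < A `^ r + B `^ r by rewrite addr_gt0.
have [S S0 Sr] : exists2 S, 0 < S & S `^ r = A `^ r + B `^ r.
  exists ((A `^ r + B `^ r) `^ r^-1); first by rewrite powR_gt0.
  by rewrite -powRrM mulVf// powRr1// ltW.
rewrite -Sr; apply: ler_powR2r; [exact: ltW|exact: ltW|].
have Srgt0 : 0 < S `^ r by rewrite powR_gt0.
have [l l_def] : exists l, l = A `^ r / S `^ r by eexists.
have l01 : 0 <= l <= 1.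
  by rewrite l_def divr_ge0 ?powR_ge0//= ler_pdivrMr// mul1r Sr lerDl ltW.
have /andP[l0 l1] := l01.
have l1' : 0 <= 1 - l by rewrite subr_ge0.
have lE : 1 - l = B `^ r / S `^ r by rewrite l_def Sr; field; rewrite gt_eqF.
have SA0 : 0 <= S / A by rewrite divr_ge0// ltW.
have SB0 : 0 <= S / B by rewrite divr_ge0// ltW.
have div_pow c : 0 < c -> c `^ r / S `^ r * (S / c) `^ r = 1.
  move=> c0; have cr : 0 < c `^ r by rewrite powR_gt0.
  rewrite powRM ?invr_ge0 ?(ltW S0) ?(ltW c0)// powRV ?(ltW c0)//.
  by field; rewrite !gt_eqF.
have lA : l * (S / A) `^ r = 1 by rewrite l_def div_pow.
have lB : (1 - l) * (S / B) `^ r = 1 by rewrite lE div_pow.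
(* These coefficients are (A / S)^(r-1) and (B / S)^(r-1), the gradient of the l_r norm at (A,
   B). *)
have := lin (l * (S / A)) ((1 - l) * (S / B)).
have -> : l * (S / A) * A + (1 - l) * (S / B) * B = S.
  by field; rewrite !gt_eqF.
apply; [exact: mulr_ge0|exact: mulr_ge0|] => x y.
have s0 : 0 <= `|x| `^ p by exact: powR_ge0.
have t0 : 0 <= k * `|y| `^ p by rewrite mulr_ge0 ?powR_ge0.
have W_ge := pointwise x y; have W_ge0 := w0 x y.
move: (`|x| `^ p) (k * `|y| `^ p) (2^-1 * (`|x + y| `^ p + `|x - y| `^ p)) s0 t0 W_ge W_ge0.
move=> s t w s0 t0 W_ge W_ge0.
have sA : 0 <= S / A * s by exact: mulr_ge0.
have tB : 0 <= S / B * t by exact: mulr_ge0.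
rewrite -[l * _ * s]mulrA -[(1 - l) * _ * t]mulrA.
apply: root => //; first by apply: addr_ge0; apply: mulr_ge0.
apply: le_trans W_ge.
apply: le_trans (powR_convex r1 l01 sA tB) _.
by rewrite (powRM r SA0 s0) (powRM r SB0 t0) mulrA lA [X in _ + X]mulrA lB !mul1r.
Qed.

End MeanPmass.

(** [mean_pmass] with r = m/p and k = kappa^(p/m) bounds the left side by a power m/p of a mean, and
    Jensen turns that into the mean of the m-th powers. *)
Lemma pnorm_convex (m kappa : R) u v : p <= m -> 0 <= kappa ->
  (forall x y : E, `|x| `^ m + kappa * `|y| `^ m <=
                   (2^-1 * (`|x + y| `^ p + `|x - y| `^ p)) `^ (m / p)) ->
  pnorm u `^ m + kappa * pnorm v `^ m <=
  2^-1 * (pnorm (u + v) `^ m + pnorm (u - v) `^ m).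
Proof.
move=> pm kappa0 E_convex.
have r1 : 1 <= m / p by rewrite ler_pdivlMr// mul1r.
have powm t : t `^ m = (t `^ p) `^ (m / p) by rewrite -powRrM mulrC divfK ?gt_eqF.
have r0 : m / p != 0 by rewrite gt_eqF// (lt_le_trans ltr01).
have kr : (kappa `^ (m / p)^-1) `^ (m / p) = kappa by rewrite -powRrM mulVf// powRr1.
have claim (a b c d a' b' c' d' : R) : 0 <= c -> 0 <= d ->
    a `^ (m / p) = a' -> b `^ (m / p) = b' -> c `^ (m / p) = c' -> d `^ (m / p) = d' ->
    a `^ (m / p) + kappa * b `^ (m / p) <= (2^-1 * (c + d)) `^ (m / p) ->
    a' + kappa * b' <= 2^-1 * (c' + d').
  move=> c0 d0 <- <- <- <- /le_trans; apply.
  have h01 : 0 <= (2^-1 : R) <= 1 by lra.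
  have := powR_convex r1 h01 c0 d0.
  by rewrite (_ : 1 - 2^-1 = 2^-1) ?mulrDr//; field.
have := @mean_pmass (m / p) (kappa `^ (m / p)^-1) r1 (powR_ge0 _ _).
have pw (x y : E) : (`|x| `^ p) `^ (m / p) + (kappa `^ (m / p)^-1 * `|y| `^ p) `^ (m / p) <=
    (2^-1 * (`|x + y| `^ p + `|x - y| `^ p)) `^ (m / p).
  by rewrite powRM ?powR_ge0// kr -!powm; exact: E_convex.
move=> /(_ pw u v).
rewrite (powRM _ (powR_ge0 kappa _) (pmass_ge0 v)) kr => H.
have EN' (a b : R) : a = b `^ p -> a `^ (m / p) = b `^ m by move=> ->; rewrite -powm.
have EN (w : ccfun) := EN' _ _ (pmassE w).
exact: claim (pmass_ge0 _) (pmass_ge0 _) (EN u) (EN v) (EN (u + v)) (EN (u - v)) H.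
Qed.

End NormConvexity.

(** * Flows and commutators *)

Section Flows.
Variables (R : realType) (V : lmodType R) (N : V -> R).
Hypothesis ler_ND : forall u v, N (u + v) <= N u + N v.
Hypothesis NZ : forall (a : R) u, N (a *: u) = `|a| * N u.

Let NN u : N (- u) = N u.
Proof. by rewrite -scaleN1r NZ normrN1 mul1r. Qed.

Let N0 : N 0 = 0.
Proof. by rewrite -(scale0r 0) NZ normr0 mul0r. Qed.

Let NBC u v : N (u - v) = N (v - u).
Proof. by rewrite -NN opprB. Qed.

Section OneFlow.
Variable P : R -> {linear V -> V}.
Hypothesis P0 : forall u, P 0 u = u.
Hypothesis PD : forall a b u, P (a + b) u = P a (P b u).
Hypothesis NP : forall a u, N (P a u) = N u.

(** The right derivative of P_e g at e = 0 in the norm N, spelled out since V carries no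
    topology. *)
Definition flow_derivative (g w : V) := forall delta : R, 0 < delta ->
  exists2 e0 : R, 0 < e0 & forall e, 0 < e -> e < e0 ->
    N (P e g - g - e *: w) <= delta * e.

Lemma flow_derivativeD g w g' w' : flow_derivative g w -> flow_derivative g' w' ->
  flow_derivative (g + g') (w + w').
Proof.
move=> Hg Hg' d d0; have d20 : 0 < d / 2 by rewrite divr_gt0.
have [e1 e10 H1] := Hg _ d20; have [e2 e20 H2] := Hg' _ d20.
exists (Num.min e1 e2); first by rewrite lt_min e10.
move=> e e0; rewrite lt_min => /andP[ee1 ee2].
have -> : P e (g + g') - (g + g') - e *: (w + w') =
    (P e g - g - e *: w) + (P e g' - g' - e *: w').
  by rewrite [P e _]linearD scalerDr !opprD [LHS](AC (2 * 2 * 2) (1 * 3 * 5 * (2 * 4 * 6))).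
apply: le_trans (ler_ND _ _) _.
by have := H1 e e0 ee1; have := H2 e e0 ee2; lra.
Qed.

Lemma flow_derivativeZ a g w : flow_derivative g w -> flow_derivative (a *: g) (a *: w).
Proof.
move=> Hg d d0; have a1 : 0 < `|a| + 1 by rewrite ltr_wpDl.
have [e1 e10 H1] := Hg _ (divr_gt0 d0 a1).
exists e1 => // e e0 ee1.
have -> : P e (a *: g) - a *: g - e *: (a *: w) = a *: (P e g - g - e *: w).
  by rewrite [P e _]linearZ /= !scalerBr !scalerA [e * a]mulrC.
rewrite NZ; apply: le_trans (ler_wpM2l (normr_ge0 a) (H1 e e0 ee1)) _.
rewrite mulrA ler_pM2r// mulrCA -[leRHS]mulr1 ler_pM2l// ler_pdivrMr// mul1r.
by rewrite lerDl.
Qed.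

Lemma flow_derivative_commute (T : {linear V -> V}) g w :
  (forall u, N (T u) = N u) -> (forall e u, P e (T u) = T (P e u)) ->
  flow_derivative g w -> flow_derivative (T g) (T w).
Proof.
move=> NT TP Hg d d0; have [e1 e10 H1] := Hg _ d0.
exists e1 => // e e0 ee1; rewrite TP.
have -> : T (P e g) - T g - e *: T w = T (P e g - g - e *: w).
  by rewrite [RHS]linearB [T (e *: w)]linearZ [T (P e g - g)]linearB.
by rewrite NT; exact: H1.
Qed.

Lemma flow_derivative_dyadic_diff (T : nat -> {linear V -> V}) k g w :
  (forall k u, N (T k u) = N u) -> (forall k e u, P e (T k u) = T k (P e u)) ->
  flow_derivative g w -> flow_derivative (dyadic_diff T k g) (dyadic_diff T k w).
Proof.
move=> NT PT gw.
have avg l : flow_derivative (dyadic_avg T l g) (dyadic_avg T l w).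
  elim: l => //= l IHl; apply: flow_derivativeZ; apply: flow_derivativeD => //.
  exact: (flow_derivative_commute (NT l) (PT l)).
have diffE u : dyadic_diff T k u = T k (dyadic_avg T k u) + (-1) *: dyadic_avg T k u.
  by rewrite scaleN1r.
rewrite !diffE; apply: flow_derivativeD; last exact: flow_derivativeZ.
exact: (flow_derivative_commute (NT k) (PT k)).
Qed.

(** Cut the time a into n equal steps. As P acts by isometries, every step displaces g by at most
    the first one, which is (a / n) N w up to an error eta / n. *)
Lemma flow_displacement_le g w a : 0 <= a -> flow_derivative g w ->
  N (P a g - g) <= a * N w.
Proof.
rewrite le_eqVlt => /predU1P[<-|a0] Hg; first by rewrite P0 subrr N0 mul0r.
have steps t n : N (P (t *+ n) g - g) <= N (P t g - g) *+ n.
  elim: n => [|n IHn]; first by rewrite !mulr0n P0 subrr N0.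
  rewrite !mulrS PD.
  have -> : P t (P (t *+ n) g) - g = (P t g - g) + P t (P (t *+ n) g - g).
    by rewrite [P t (_ - g)]linearB /= [RHS]addrC [RHS]addrA subrK.
  by apply: le_trans (ler_ND _ _) _; rewrite NP lerD2l.
apply/ler_addgt0Pr => eta eta0.
have [e0 e00 He] := Hg _ (divr_gt0 eta0 a0).
have [n n0 an] : exists2 n : nat, (0 < n)%N & a / n%:R < e0.
  exists (Num.bound (a / e0)).+1 => //.
  rewrite ltr_pdivrMr ?ltr0n// mulrC -ltr_pdivrMr//.
  apply: lt_trans (archi_boundP _) _; first by rewrite divr_ge0// ltW.
  by rewrite ltr_nat.
have n0' : 0 < n%:R :> R by rewrite ltr0n.
have aE : a = (a / n%:R) *+ n by rewrite -mulr_natr divfK ?gt_eqF.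
have an0 : 0 < a / n%:R by rewrite divr_gt0.
rewrite {1}aE; apply: le_trans (steps _ _) _.
have : N (P (a / n%:R) g - g) <= eta / a * (a / n%:R) + (a / n%:R) * N w.
  have -> : P (a / n%:R) g - g =
      (P (a / n%:R) g - g - (a / n%:R) *: w) + (a / n%:R) *: w by rewrite subrK.
  apply: le_trans (ler_ND _ _) _; rewrite NZ ger0_norm ?(ltW an0)// lerD2r.
  exact: He.
move=> step; rewrite -[leLHS]mulr_natr; apply: le_trans (ler_wpM2r (ltW n0') step) _.
by rewrite le_eqVlt; apply/orP; left; apply/eqP; field; rewrite !gt_eqF.
Qed.

End OneFlow.

(* The vertical displacement by a^2 is the commutator of two horizontal flows
   at time a. *)
Lemma commutator_displacement_le (A B : R -> {linear V -> V}) (Z : {linear V -> V})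
    (a : R) g wA wB :
  (forall u, A 0 u = u) -> (forall s t u, A (s + t) u = A s (A t u)) ->
  (forall s u, N (A s u) = N u) ->
  (forall u, B 0 u = u) -> (forall s t u, B (s + t) u = B s (B t u)) ->
  (forall s u, N (B s u) = N u) ->
  (forall u, B a (A (- a) (Z u)) = A (- a) (B a u)) ->
  0 <= a -> flow_derivative A g wA -> flow_derivative B g wB ->
  N (Z g - g) <= 2 * a * (N wA + N wB).
Proof.
move=> A0 AD NA B0 BD NB comm a0 HA HB.
have dA := flow_displacement_le A0 AD NA a0 HA.
have dB := flow_displacement_le B0 BD NB a0 HB.
have dA' : N (A (- a) g - g) <= a * N wA.
  rewrite -(NA a) [A a (_ - g)]linearB /= -AD subrr A0 NBC; exact: dA.
(* The isometry B_a A_{-a} turns (Z - 1) g into the commutator of A_{-a} and B_a at g, which splits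
   into four displacements, two by each flow. *)
rewrite -(NA (- a)) -(NB a) [A (- a) (_ - g)]linearB [B a (_ - _)]linearB /= comm.
set A' := A (- a) in dA' *; set b := B a in dB *.
have -> : A' (b g) - b (A' g) =
    (A' (b g - g) + (A' g - g)) - (b (A' g - g) + (b g - g)).
  rewrite [A' (b g - g)]linearB [b (A' g - g)]linearB /=.
  by rewrite addrA subrK [b (A' g) - b g + _]addrA subrK opprB addrA subrK.
apply: le_trans (ler_ND _ _) _; rewrite NN.
have h1 := ler_ND (A' (b g - g)) (A' g - g).
have h2 := ler_ND (b (A' g - g)) (b g - g).
rewrite NA in h1; rewrite NB in h2.
lra.
Qed.

End Flows.

(** * Mean value inequality for vector-valued functions *)

Section MeanValue.
Variables (R : realType) (E : normedModType R).

Lemma derivable_linear_approx (g : R -> E) (c : E) (s0 delta eta : R) :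
  derivable g s0 1 -> `|derive1 g s0 - c| <= delta -> delta < eta ->
  exists2 rho : R, 0 < rho & forall s, `|s - s0| < rho ->
    `|g s - g s0 - (s - s0) *: c| <= eta * `|s - s0|.
Proof.
move=> dg gc de.
have : (fun h : R => h^-1 *: (g (h *: 1 + s0) - g s0)) @ 0^' --> derive1 g s0.
  by rewrite derive1E; exact: dg.
move=> /cvgrPdist_lt/(_ (eta - delta)); rewrite subr_gt0 => /(_ de).
move=> [rho /= rho0 Hrho]; exists rho => // s ss0.
have [->|sn] := eqVneq s s0; first by rewrite !subrr scale0r subr0 !normr0 mulr0.
have sn0 : s - s0 != 0 by rewrite subr_eq0.
have := Hrho (s - s0); rewrite /ball/= sub0r normrN => /(_ ss0 sn0).
rewrite /GRing.scale/= mulr1 subrK => Hlt.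
have -> : g s - g s0 - (s - s0) *: c =
    (s - s0) *: ((s - s0)^-1 *: (g s - g s0) - c).
  by rewrite scalerBr scalerA mulfV// scale1r.
rewrite normrZ mulrC ler_wpM2r//.
have -> : (s - s0)^-1 *: (g s - g s0) - c =
    (derive1 g s0 - c) - (derive1 g s0 - (s - s0)^-1 *: (g s - g s0)).
  by rewrite opprB [RHS]addrC addrA subrK.
apply: le_trans (ler_normB _ _) _; move: gc Hlt; lra.
Qed.

Let reverse_increment (g : R -> E) (c : E) (a b : R) :
  `|g b - g a - (b - a) *: c| = `|g a - g b - (a - b) *: c|.
Proof. by rewrite -normrN opprD !opprB -scaleNr opprB. Qed.

(** For any eta > delta, the set of s for which the estimate with eta holds on [a, s] contains its
    supremum t, and the linear approximation at t carries it beyond t unless t = b. *)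
Let mean_value_le (g : R -> E) (c : E) (a b delta : R) : a <= b ->
  (forall s, a <= s <= b -> derivable g s 1) ->
  (forall s, a <= s <= b -> `|derive1 g s - c| <= delta) ->
  `|g b - g a - (b - a) *: c| <= delta * (b - a).
Proof.
move=> ab dg gc.
suff main eta : delta < eta -> `|g b - g a - (b - a) *: c| <= eta * (b - a).
  apply/ler_addgt0Pr => e e0.
  have ba : 0 < b - a + 1 by rewrite ltr_wpDl// subr_ge0.
  have := main (delta + e / (b - a + 1)); rewrite ltrDl divr_gt0// => /(_ isT).
  move=> /le_trans; apply; rewrite mulrDl lerD2l mulrAC ler_pdivrMr//.
  by rewrite ler_pM2l// lerDl.
move=> de.
pose A := [set s | a <= s <= b /\ `|g s - g a - (s - a) *: c| <= eta * (s - a)].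
have Aa : A a by split; [rewrite lexx|rewrite !subrr scale0r subr0 normr0 mulr0].
have hasA : has_sup A by split; [exists a|exists b => s [/andP[]]].
pose t := sup A.
have ta : a <= t by exact: ub_le_sup hasA.2 _ Aa.
have tb : t <= b by apply: ge_sup; [exists a|move=> s [/andP[]]].
have chain s1 s2 : a <= s1 -> s1 <= s2 ->
    `|g s1 - g a - (s1 - a) *: c| <= eta * (s1 - a) ->
    `|g s2 - g s1 - (s2 - s1) *: c| <= eta * (s2 - s1) ->
    `|g s2 - g a - (s2 - a) *: c| <= eta * (s2 - a).
  move=> as1 s12 h1 h2.
  have -> : g s2 - g a - (s2 - a) *: c =
      (g s2 - g s1 - (s2 - s1) *: c) + (g s1 - g a - (s1 - a) *: c).
    rewrite addrACA -opprD -scalerDl; congr (_ - _ *: c); first by rewrite addrA subrK.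
    by rewrite addrA subrK.
  by apply: le_trans (ler_normD _ _) _; lra.
have tab : a <= t <= b by rewrite ta.
have [rho rho0 Hrho] := derivable_linear_approx (dg t tab) (gc t tab) de.
have At : A t.
  have [s As st] := sup_adherent rho0 hasA.
  have st' : s <= t by exact: ub_le_sup hasA.2 _ As.
  have [/andP[as_ sb] gs] := As; split => //.
  apply: (chain _ _ as_ st' gs).
  have st_abs : `|s - t| = t - s by rewrite distrC ger0_norm ?subr_ge0.
  have := Hrho s; rewrite st_abs reverse_increment; apply.
  by rewrite -/t in st; lra.
have [bt|tlt] := leP b t.
  have <- : t = b by apply/eqP; rewrite eq_le tb.
  by case: At.
pose s := Num.min b (t + rho / 2).
have ts : t < s by rewrite lt_min tlt ltrDl divr_gt0.
have sb : s <= b by rewrite ge_min lexx.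
have srho : s <= t + rho / 2 by rewrite ge_min lexx orbT.
have As : A s.
  split; first by rewrite sb (le_trans ta (ltW ts)).
  apply: chain ta (ltW ts) At.2 _.
  have := Hrho s; rewrite ger0_norm ?subr_ge0 ?(ltW ts)//; apply; lra.
by have := ub_le_sup hasA.2 As; rewrite -/t leNgt ts.
Qed.

Lemma mean_value_dist (g : R -> E) (c : E) (a b delta : R) :
  (forall s, derivable g s 1) ->
  (forall s, `|s - a| <= `|b - a| -> `|derive1 g s - c| <= delta) ->
  `|g b - g a - (b - a) *: c| <= delta * `|b - a|.
Proof.
move=> dg gc; have [ab|ba] := leP a b.
  rewrite [`|b - a|]ger0_norm ?subr_ge0//; apply: mean_value_le => // s /andP[as_ sb].
  by apply: gc; rewrite !ger0_norm ?subr_ge0// lerD2r.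
have ba_abs : `|b - a| = a - b by rewrite distrC ger0_norm ?subr_ge0// ltW.
rewrite ba_abs reverse_increment.
apply: mean_value_le => //; first exact: ltW.
move=> s /andP[bs sa]; apply: gc.
by rewrite ba_abs distrC ger0_norm ?subr_ge0// lerD2l lerN2.
Qed.

End MeanValue.

(** * Horizontal derivatives on the Heisenberg group *)

Lemma sqrt2_bounds (R : rcfType) : 4 / 3 <= Num.sqrt (2 : R) <= 3 / 2.
Proof.
have h2 : Num.sqrt (2 : R) ^+ 2 = 2 by rewrite sqr_sqrtr.
have h0 : 0 <= Num.sqrt (2 : R) by rewrite sqrtr_ge0.
by apply/andP; split; rewrite -(@ler_pXn2r _ 2) ?nnegrE ?h2//; lra.
Qed.

Section SmoothFunction.
Variables (R : realType) (E : normedModType R).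
Local Notation T3 := ((R * R) * R)%type.
Variable f : T3 -> E.
Hypothesis f_smooth : smooth f.

Let continuous_f : continuous f. Proof. exact: (f_smooth [::]).1. Qed.
Let continuous_partial d : continuous (partial d f). Proof. exact: (f_smooth [:: d]).1. Qed.

Lemma sliceK d (h : T3) : slice d h (coordv d h) = h.
Proof. by case: d; case: h => [[]]. Qed.

Lemma slice_slice d (h : T3) s t : slice d (slice d h s) t = slice d h t.
Proof. by case: d. Qed.

Lemma coordv_slice d (h : T3) s : coordv d (slice d h s) = s.
Proof. by case: d. Qed.

Let derivable_slice d h s : derivable (fun t => f (slice d h t)) s 1.
Proof.
have := (f_smooth [::]).2 d (slice d h s); rewrite coordv_slice.
by under eq_fun do rewrite slice_slice.
Qed.

Let derive1_slice d h s :
  derive1 (fun t => f (slice d h t)) s = partial d f (slice d h s).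
Proof.
rewrite /partial coordv_slice; congr (derive1 _ _).
by apply/funext => t; rewrite slice_slice.
Qed.

(** Some coordinate i of h exceeds r in absolute value. Moving along d either leaves it unchanged or
    keeps it above r for displacements below |h_i| - r, so f vanishes along the slice near h. *)
Lemma partial_support d r : (forall h, ~ cube r h -> f h = 0) ->
  forall h, ~ cube r h -> partial d f h = 0.
Proof.
move=> fr h hr.
have [i ri] : exists i, r < `|coordv i h|.
  have [h1|h1] := ltP r `|h.1.1|; first by exists Cx.
  have [h2|h2] := ltP r `|h.1.2|; first by exists Cy.
  have [h3|h3] := ltP r `|h.2|; first by exists Cz.
  by case: hr; apply/cubeE.
have out s : `|s - coordv d h| < `|coordv i h| - r -> f (slice d h s) = 0.
  move=> sd; apply: fr => /cubeE[h1 h2 h3].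
  have : `|coordv i (slice d h s)| <= r by case: (i).
  have [di|di] : coordv i (slice d h s) = coordv i h \/
                 coordv i (slice d h s) = s /\ coordv d h = coordv i h.
    by case: (d) (i) => -[]; (by left) || (by right).
  - by rewrite di leNgt ri.
  - case: di => -> di; rewrite di in sd.
    by have := ler_normB (coordv i h - s) (- s); rewrite opprK subrK normrN distrC; lra.
rewrite /partial derive1E; apply/cvg_lim => //.
apply: cvg_near_cst; exists (`|coordv i h| - r) => /=; first by rewrite subr_gt0.
move=> t; rewrite /ball/= sub0r normrN => tr _.
have -> : f (slice d h (coordv d h)) = 0 by apply: out; rewrite subrr normr0 subr_gt0.
have -> : f (slice d h (t *: 1 + coordv d h)) = 0.
  by apply: out; rewrite /GRing.scale/= mulr1 addrK.
by rewrite subrr scaler0.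
Qed.

Lemma partial_increment d h s (c : E) delta :
  (forall s', `|s' - coordv d h| <= `|s - coordv d h| ->
     `|partial d f (slice d h s') - c| <= delta) ->
  `|f (slice d h s) - f h - (s - coordv d h) *: c| <= delta * `|s - coordv d h|.
Proof.
move=> H; rewrite -[in X in _ - X - _](sliceK d h).
apply: (mean_value_dist (g := fun t => f (slice d h t))); first exact: derivable_slice.
by move=> s' /H; rewrite derive1_slice.
Qed.

Hypothesis f_compact : compact_support f.

Lemma cc_f : f \in @cc_pred R E. Proof. by apply/cc_predP. Qed.

Lemma cc_partial d : partial d f \in @cc_pred R E.
Proof.
apply/cc_predP; split; first exact: continuous_partial.
have [r _ fr] := compact_supportP f_compact.
exact: compact_support_cube (partial_support d fr).
Qed.

Let F := CCFun cc_f.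

(** Treats X ([Cx]) and Y ([Cy]) uniformly; the value at [Cz] is a dummy. *)
Let slope (d : Defs.coord) (h : T3) : R :=
  match d with Cx => h.1.2 / 2 | _ => - (h.1.1 / 2) end.

Let horizontal d h := partial d f h + slope d h *: partial Cz f h.

Let cc_horizontal d : horizontal d \in @cc_pred R E.
Proof.
have [r _ fr] := compact_supportP f_compact.
apply/cc_predP; split.
  move=> h; apply: cvgD; first exact: continuous_partial.
  apply: cvgZ; last exact: continuous_partial.
  have c1 : continuous (fun h : T3 => h.1.1).
    by move=> t; apply: (@continuous_comp _ _ _ (fun h : T3 => h.1) (fun w : R * R => w.1));
      exact: cvg_fst.
  have c2 : continuous (fun h : T3 => h.1.2).
    by move=> t; apply: (@continuous_comp _ _ _ (fun h : T3 => h.1) (fun w : R * R => w.2));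
      [exact: cvg_fst|exact: cvg_snd].
  by case: d; [|apply: cvgN|apply: cvgN]; apply: cvgMl; [exact: c2|exact: c1|exact: c1].
apply: (@compact_support_cube _ _ _ r) => h hr.
by rewrite /horizontal !(partial_support _ fr hr) scaler0 addr0.
Qed.

Let W d : ccfun E := CCFun (cc_horizontal d).

(** The flow of X or Y at time e: its slope is constant along the orbit, as X moves only x and z
    while its slope depends on y, and likewise for Y. The endpoint is reached by a vertical segment
    and a coordinate segment, so that [partial_increment] applies to each. *)
Let move_to (d : Defs.coord) (e : R) (h : T3) : T3 :=
  slice d (slice Cz h (h.2 + e * slope d h)) (coordv d h + e).

Let move_increment d h e delta : d <> Cz ->
  (forall h', `|h'.1.1 - h.1.1| <= `|e| -> `|h'.1.2 - h.1.2| <= `|e| ->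
     `|h'.2 - h.2| <= `|e * slope d h| ->
     `|partial d f h' - partial d f h| <= delta /\
     `|partial Cz f h' - partial Cz f h| <= delta) ->
  `|f (move_to d e h) - f h - e *: horizontal d h| <= delta * (`|e| + `|e * slope d h|).
Proof.
move=> dz H; set k := slope d h in H *; set h1 := slice Cz h (h.2 + e * k).
have c1 : coordv d h1 = coordv d h by case: (d) dz.
have v : `|f h1 - f h - (e * k) *: partial Cz f h| <= delta * `|e * k|.
  have := @partial_increment Cz h (h.2 + e * k) (partial Cz f h) delta.
  rewrite /= addrAC subrr add0r; apply => s' hs'.
  by have [] := H (slice Cz h s'); rewrite /= ?subrr ?normr0.
have u : `|f (move_to d e h) - f h1 - e *: partial d f h| <= delta * `|e|.
  have := @partial_increment d h1 (coordv d h1 + e) (partial d f h) delta.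
  rewrite [coordv d h1 + e]addrC addrK c1 addrC; apply => s' hs'.
  have ek : `|h.2 + e * k - h.2| <= `|e * k| by rewrite addrAC subrr add0r.
  by have [] := H (slice d h1 s'); move: hs'; rewrite /h1; case: (d) dz => //= _ hs';
    rewrite ?subrr ?normr0.
rewrite mulrDr; apply: le_trans (lerD u v); apply: le_trans (ler_normD _ _).
rewrite le_eqVlt; apply/orP; left; apply/eqP; congr `|_|.
rewrite /horizontal -/k scalerDr scalerA opprD.
by rewrite [RHS]addrACA [f _ - f h1 + _]addrA subrK.
Qed.

Let flow (d : Defs.coord) (e : R) : {linear ccfun E -> ccfun E} :=
  if d is Cx then pull e 0 0 0 (e / 2) : {linear _ -> _}
  else pull 0 e 0 (- (e / 2)) 0 : {linear _ -> _}.

Let flowE d e h : d <> Cz -> flow d e F h = f (move_to d e h).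
Proof.
by case: d => // _; rewrite /flow /move_to /shear /=; congr f;
  (congr ((_, _), _); rewrite ?addr0//); ring.
Qed.

Let flow_uniform d : d <> Cz -> forall delta : R, 0 < delta ->
  exists2 e0 : R, 0 < e0 & forall e, 0 < e -> e < e0 -> forall h,
    `|(flow d e F - F - e *: W d) h| <= delta * e.
Proof.
move=> dz delta delta0.
have [r r0 fr] := compact_supportP f_compact.
have eta0 : 0 < delta / (1 + r) by rewrite divr_gt0// ltr_wpDr.
have [d1 d10 H1] := ccfun_uniform (CCFun (cc_partial d)) eta0.
have [d2 d20 H2] := ccfun_uniform (CCFun (cc_partial Cz)) eta0.
pose dm := Num.min d1 d2.
have dm0 : 0 < dm by rewrite lt_min d10.
have r1 : 0 < 1 + r by rewrite ltr_wpDr.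
exists (dm / (1 + r)); first by rewrite divr_gt0.
move=> e e0 edm h; rewrite !ccfunB ccfunZ flowE//=.
have edm' : e * (1 + r) < dm by rewrite -ltr_pdivlMr.
have er : 0 <= e * r by rewrite mulr_ge0// ltW.
(* The slope is unbounded in h. When the coordinate that it depends on exceeds r, it does so along
   the whole orbit, which avoids the support; otherwise the slope is at most r. *)
have [big|small] := ltP r (if d is Cx then `|h.1.2| else `|h.1.1|).
  have out h' : (if d is Cx then h'.1.2 = h.1.2 else h'.1.1 = h.1.1) -> ~ cube r h'.
    move=> hh /cubeE[b1 b2 b3]; move: big hh.
    by case: (d) => /= big hh; move: big; rewrite -hh ltNge ?b1 ?b2.
  rewrite /horizontal !(partial_support _ fr) ?scaler0 ?addr0 ?scaler0 ?subr0.
  - by rewrite !fr ?subrr ?normr0 ?mulr_ge0 ?ltW//; apply: out; case: (d) dz.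
  - by apply: out; case: (d).
  - by apply: out; case: (d).
have slope_le : `|slope d h| <= r.
  have half (x : R) : `|x| <= r -> `|x / 2| <= r.
    by rewrite normrM [`|2^-1|]ger0_norm ?invr_ge0//; have := normr_ge0 x; lra.
  by move: small; rewrite /slope; case: (d) => hr; rewrite ?normrN; exact: half.
have eabs : `|e| = e by rewrite ger0_norm// ltW.
have es : `|e * slope d h| <= e * r by rewrite normrM eabs ler_wpM2l// ltW.
have := @move_increment d h e (delta / (1 + r)) dz.
move=> /(_ _)/le_trans -> //; last first.
  rewrite mulrAC ler_pdivrMr// -mulrA ler_pM2l// eabs; lra.
move=> h' b1 b2 b3.
have near_h : ball h' dm h.
  by split; [split|]; rewrite /ball/=; lra.
split.
- by apply: (H1 h' h); apply: le_ball near_h; rewrite ge_min lexx.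
- by apply: (H2 h' h); apply: le_ball near_h; rewrite ge_min lexx orbT.
Qed.

(** A support common to all times e < 1, so that the uniform estimate of [flow_uniform] becomes one
    in L_p, at the cost of the cube's volume to the power 1/p. *)
Let flow_support d : exists s : R, 0 <= s /\ forall e h, 0 < e -> e < 1 -> ~ cube s h ->
  (flow d e F - F - e *: W d) h = 0.
Proof.
have [r r0 fr] := compact_supportP f_compact.
exists (2 * r + 2); split; first lra.
move=> e h e0 e1 hs; rewrite !ccfunB ccfunZ /=.
have hr : ~ cube r h by move=> hr; apply: hs; apply: subset_cube hr; lra.
rewrite /horizontal !(partial_support _ fr hr) (fr _ hr) scaler0 addr0 scaler0 !subr0.
have er : e * r <= r by rewrite ler_piMl// ltW.
have er0 : 0 <= e * r by rewrite mulr_ge0// ltW.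
have ee : `|e| = e by rewrite ger0_norm// ltW.
have ee2 : `|e / 2| = e / 2 by rewrite ger0_norm// divr_ge0// ltW.
by case: d => /=; apply: (shear_support r0 fr) => hc; apply: hs; apply: subset_cube hc;
  rewrite ?normrN !normr0 ee ee2; lra.
Qed.

Section Derivative.
Variable p : R.
Hypothesis p1 : 1 < p.
Let p0 : 0 < p. Proof. exact: lt_trans p1. Qed.

Let flow_derivative_W d : d <> Cz -> flow_derivative (@pnorm R E p) (flow d) F (W d).
Proof.
move=> dz delta delta0.
have [s [s0 Hs]] := flow_support d.
pose C := ((2 * s) ^+ 3) `^ p^-1.
have C0 : 0 <= C by exact: powR_ge0.
have Cp : C `^ p = (2 * s) ^+ 3.
  by rewrite -powRrM mulVf ?gt_eqF// powRr1// exprn_ge0// mulr_ge0.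
have C1 : 0 < C + 1 by rewrite ltr_wpDl.
have [e1 e10 H1] := flow_uniform dz (divr_gt0 delta0 C1).
exists (Num.min e1 1); first by rewrite lt_min e10 ltr01.
move=> e e0; rewrite lt_min => /andP[ee1 e_1].
set u := flow d e F - F - e *: W d.
have bound : pnorm p u <= delta / (C + 1) * e * C.
  have de0 : 0 <= delta / (C + 1) * e by rewrite mulr_ge0 ?divr_ge0 ?ltW.
  apply: (pnorm_le p1); first exact: mulr_ge0.
  rewrite powRM// Cp; apply: (pmass_le_cube p1 s0).
    exact: H1 e e0 ee1.
  by move=> h; exact: Hs.
apply: le_trans bound _; rewrite -mulrA [e * C]mulrC mulrA ler_pM2r//.
by rewrite mulrAC ler_pdivrMr// ler_pM2l// lerDl.
Qed.

Local Notation N := (@pnorm R E p).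

Let flow0 d u : flow d 0 u = u.
Proof.
by apply: ccfun_ext => -[[x y] z]; case: d; rewrite /= /shear /=; congr (u ((_, _), _)); ring.
Qed.

Let flowD d s t u : flow d (s + t) u = flow d s (flow d t u).
Proof.
by apply: ccfun_ext => -[[x y] z]; case: d; rewrite /= /shear /=; congr (u ((_, _), _)); field.
Qed.

Let N_flow d s u : N (flow d s u) = N u.
Proof. by case: d; exact: pnorm_pull. Qed.

Definition vertical_shift t : {linear ccfun E -> ccfun E} := pull 0 0 t 0 0.
Local Notation tau := vertical_shift.

Let flow_tau d s t u : flow d s (tau t u) = tau t (flow d s u).
Proof.
by apply: ccfun_ext => -[[x y] z]; case: d; rewrite /= /shear /=; congr (u ((_, _), _)); ring.
Qed.

Lemma tauD s t u : tau (s + t) u = tau s (tau t u).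
Proof.
by apply: ccfun_ext => -[[x y] z]; rewrite /= /shear /=; congr (u ((_, _), _)); ring.
Qed.

Lemma N_tau t u : N (tau t u) = N u. Proof. exact: pnorm_pull. Qed.

Let flow_commutator t u (a := Num.sqrt t) : 0 <= t ->
  flow Cy a (flow Cx (- a) (tau t u)) = flow Cx (- a) (flow Cy a u).
Proof.
move=> t0; have -> : t = a * a by rewrite -expr2 sqr_sqrtr.
by apply: ccfun_ext => -[[x y] z]; rewrite /= /shear /=; congr (u ((_, _), _)); field.
Qed.

Let vertical_le t u wX wY : 0 <= t ->
  flow_derivative N (flow Cx) u wX -> flow_derivative N (flow Cy) u wY ->
  N (tau t u - u) <= 2 * Num.sqrt t * (N wX + N wY).
Proof.
move=> t0 uX uY.
apply: (@commutator_displacement_le R _ N (@pnorm_triangle R E p p1) (@pnormZ R E p p1)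
  (flow Cx) (flow Cy) (tau t) (Num.sqrt t) u wX wY (flow0 Cx) (flowD Cx) (N_flow Cx)
  (flow0 Cy) (flowD Cy) (N_flow Cy) _ (sqrtr_ge0 t) uX uY).
by move=> v; exact: flow_commutator.
Qed.

Let flow_derivative_diff (T : nat -> {linear ccfun E -> ccfun E}) d k u w
    (NT : forall k u, N (T k u) = N u)
    (fT : forall k s u, flow d s (T k u) = T k (flow d s u)) :=
  @flow_derivative_dyadic_diff R _ N (@pnorm_triangle R E p p1) (@pnormZ R E p p1)
    (flow d) T k u w NT fT.

Definition cc_smooth : ccfun E := F.
Definition cc_X : ccfun E := W Cx.
Definition cc_Y : ccfun E := W Cy.

Lemma cc_XE h : cc_X h = Xf f h. Proof. by []. Qed.
Lemma cc_YE h : cc_Y h = Yf f h. Proof. by rewrite /Yf -scaleNr. Qed.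

(** Makes the displacement 1/2-Hölder in t, hence the integrand of the vertical square function
    continuous. *)
Lemma vertical_displacement_le t : 0 <= t ->
  N (tau t cc_smooth - cc_smooth) <= 2 * Num.sqrt t * (N cc_X + N cc_Y).
Proof. by move=> t0; apply: vertical_le => //; exact: flow_derivative_W. Qed.

Lemma dyadic_vertical_bound (m kappa t G : R) n : p <= m -> 0 < kappa -> 0 < t ->
  (forall x y : E, `|x| `^ m + kappa * `|y| `^ m <=
                   (2^-1 * (`|x + y| `^ p + `|x - y| `^ p)) `^ (m / p)) ->
  N cc_X <= G -> N cc_Y <= G ->
  \sum_(j < n) (N (tau (2 ^+ j * t) cc_smooth - cc_smooth) / Num.sqrt (2 ^+ j * t)) `^ m
    <= 128 `^ m / kappa * G `^ m.
Proof.
move=> pm kappa0 t0 E_convex XG YG.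
have m1 : 1 <= m by exact: le_trans (ltW p1) pm.
have s0 k : 0 < 2 ^+ k * t by rewrite mulr_gt0 ?exprn_gt0.
have N_convex (u v : ccfun E) :
    N u `^ m + kappa * N v `^ m <= 2^-1 * (N (u + v) `^ m + N (u - v) `^ m).
  exact: (pnorm_convex p1 u v pm (ltW kappa0) E_convex).
have /andP[sqrt2_ge sqrt2_le] := sqrt2_bounds R.
apply: (@dyadic_translation_bound R _ N (pnorm_ge0 p) (pnorm_triangle p1) (pnormZ p1)
  m kappa m1 kappa0 N_convex (fun k => tau (2 ^+ k * t)) _ _
  (fun k => Num.sqrt (2 ^+ k * t)) _ _ cc_smooth cc_X cc_Y _ n G XG YG).
- by move=> k u; exact: N_tau.
- by move=> k u; rewrite -tauD exprS; congr (tau _ u); ring.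
- by move=> k; rewrite sqrtr_gt0.
- move=> k; have -> : 2 ^+ k.+1 * t = 2 * (2 ^+ k * t) by rewrite exprS mulrA.
  by rewrite [Num.sqrt (2 * _)]sqrtrM// !ler_wpM2r// sqrtr_ge0.
- move=> k; apply: vertical_le; first exact: ltW.
    by apply: flow_derivative_diff => *; [exact: N_tau|exact: flow_tau|exact: flow_derivative_W].
  by apply: flow_derivative_diff => *; [exact: N_tau|exact: flow_tau|exact: flow_derivative_W].
Qed.

End Derivative.

End SmoothFunction.

(** * Integration over dyadic scales *)

Section DyadicIntegral.
Variable R : realType.
Local Notation mu := (@lebesgue_measure R).
Variables (phi : R -> R) (M : R).
Hypothesis phi_ge0 : forall t, 0 <= phi t.
Hypothesis phi_cont : forall t, 0 < t -> {for t, continuous phi}.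
Hypothesis phi_sum : forall t n, 0 < t -> \sum_(j < n) phi (2 ^+ j * t) <= M.

Let psi t := phi t * t^-1.

Let psi_ge0 t : 0 < t -> 0 <= psi t.
Proof. by move=> t0; rewrite mulr_ge0// invr_ge0 ltW. Qed.

Let psi_cont t : 0 < t -> {for t, continuous psi}.
Proof.
by move=> t0; apply: cvgM; [exact: phi_cont|apply: cvgV; [rewrite gt_eqF|exact: cvg_id]].
Qed.

Let psi_within (a b : R) : 0 < a -> {within `[a, b], continuous psi}.
Proof.
move=> a0; apply: continuous_in_subspaceT => t.
by rewrite inE/= in_itv/= => /andP[a_t _]; apply: psi_cont; exact: lt_le_trans a_t.
Qed.

Let measurable_psi (a b : R) : 0 < a -> measurable_fun (`[a, b] : set R) (fun t => (psi t)%:E).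
Proof.
move=> a0; apply/measurable_EFinP.
by apply: subspace_continuous_measurable_fun => //; exact: psi_within.
Qed.

(** Scale invariance of dt/t. *)
Let scaled (c a : R) : 0 < c -> 0 < a ->
  (\int[mu]_(t in `[(c * a)%R, (c * (2 * a))%R]) (psi t)%:E =
   \int[mu]_(t in `[a, (2 * a)%R]) (phi (c * t) * t^-1)%R%:E)%E.
Proof.
move=> c0 a0; have a2 : a <= 2 * a by lra.
have dc (x : R) : is_derive x (1 : R) (fun x : R => c * x) c.
  have := @is_deriveZ R R R id c x 1 1 (is_derive_id x 1).
  by rewrite /GRing.scale/= mulr1.
have d1 : (fun x : R => c * x)^`()%classic = cst c.
  by apply/funext => x; rewrite derive1E; apply: derive_val.
rewrite (@integration_by_substitution_increasing R (fun x => c * x) psi a (2 * a))//.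
- apply: eq_integral => t; rewrite inE/= in_itv/= => /andP[a_t _]; congr (_%:E).
  have t0 : 0 < t by exact: lt_le_trans a_t.
  transitivity (psi (c * t) * c); first by rewrite -[in RHS](_ : (fun x : R => c * x)^`()%classic t = c)// d1.
  by rewrite /psi; field; rewrite !gt_eqF.
- by move=> x y _ _ xy; rewrite ltr_pM2l.
- by rewrite d1 => x _; exact: cvg_cst.
- by rewrite d1; exact: is_cvg_cst.
- by rewrite d1; exact: is_cvg_cst.
- have cc : continuous (fun x : R => c * x) by move=> x; apply: cvgMr; exact: cvg_id.
  split.
  + by move=> x _; apply: ex_derive.
  + by apply: cvg_at_right_filter; exact: cc.
  + by apply: cvg_at_left_filter; exact: cc.
- by apply: psi_within; rewrite mulr_gt0.
Qed.

Let measurable_phi (a : R) j : 0 < a ->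
  measurable_fun (`[a, 2 * a] : set R) (fun t => (phi (2 ^+ j * t) * t^-1)%:E).
Proof.
move=> a0.
apply/measurable_EFinP; apply: subspace_continuous_measurable_fun => //.
apply: continuous_in_subspaceT => t.
rewrite inE/= in_itv/= => /andP[at_ _]; have t0 : 0 < t by exact: lt_le_trans at_.
apply: cvgM; last by apply: cvgV; [rewrite gt_eqF|exact: cvg_id].
apply: (@continuous_comp _ _ _ (fun t : R => 2 ^+ j * t) phi).
  by apply: cvgMr; exact: cvg_id.
by apply: phi_cont; rewrite mulr_gt0 ?exprn_gt0.
Qed.

(** Each doubling appends the interval [c, 2 c] with c = 2^n a, which [scaled] carries back to
    [a, 2 a]. *)
Let dyadic_block (a : R) n : 0 < a ->
  (\int[mu]_(t in `[a, (2 ^+ n * a)%R]) (psi t)%:E <=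
   \int[mu]_(t in `[a, (2 * a)%R]) (\sum_(j < n) phi (2 ^+ j * t) * t^-1)%R%:E)%E.
Proof.
move=> a0.
have pos j t : t \in `[a, 2 * a] -> 0 <= phi (2 ^+ j * t) * t^-1.
  by rewrite in_itv/= => /andP[at_ _]; rewrite mulr_ge0// invr_ge0 (le_trans (ltW a0)).
elim: n => [|n IHn].
  rewrite expr0 mul1r set_itv1 integral_set1.
  by apply: integral_ge0 => t _; rewrite big_ord0.
have mphi j := measurable_phi j a0.
have -> : (\int[mu]_(t in `[a, (2 * a)%R]) (\sum_(j < n.+1) phi (2 ^+ j * t) * t^-1)%R%:E =
    \int[mu]_(t in `[a, (2 * a)%R]) (\sum_(j < n) phi (2 ^+ j * t) * t^-1)%R%:E +
    \int[mu]_(t in `[a, (2 * a)%R]) (phi (2 ^+ n * t) * t^-1)%R%:E)%E.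
  rewrite -ge0_integralD//.
  - by apply: eq_integral => t _; rewrite big_ord_recr/= EFinD.
  - by move=> t ta; rewrite lee_fin; apply: sumr_ge0 => j _; exact: pos.
  - apply/measurable_EFinP; apply: measurable_sum => j.
    by apply/measurable_EFinP; exact: mphi.
  - by move=> t ta; rewrite lee_fin; exact: pos.
  - exact: mphi.
have pa : a <= 2 ^+ n * a by rewrite ler_pMl// exprn_ege1// ler1n.
set c := 2 ^+ n * a in pa *; have c0 : 0 < c by exact: lt_le_trans pa.
have -> : 2 ^+ n.+1 * a = 2 * c by rewrite exprS mulrA.
have mU : measurable (`[a, c] `|` `]c, 2 * c] : set R) by exact: measurableU.
have cover : `[a, 2 * c] `<=` (`[a, c] `|` `]c, 2 * c] : set R).
  move=> t; rewrite /= !in_itv/= => /andP[at_ tb].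
  by have [tn|nt] := leP t c; [left; rewrite at_|right].
have cover' : (`[a, c] `|` `]c, 2 * c] : set R) `<=` `[a, 2 * c].
  move=> t [] /=; rewrite !in_itv/= => /andP[h1 h2].
    by rewrite h1 (le_trans h2)//; lra.
  by rewrite h2 andbT (le_trans pa)// ltW.
have psi0 t : `[a, 2 * c]%classic t -> (0 <= (psi t)%:E)%E.
  by rewrite lee_fin /= in_itv/= => /andP[ta _]; apply: psi_ge0; exact: lt_le_trans ta.
have mpsi := @measurable_psi a (2 * c) a0.
have setE : (`[a, c] `|` `]c, 2 * c] : set R) = `[a, 2 * c]%classic by apply/seteqP; split.
rewrite -setE ge0_integral_setU//; last 3 first.
- exact: measurable_funS mpsi.
- by move=> t /cover'/psi0.
- by apply/disj_setPS => t /= []; rewrite !in_itv/= => /andP[_ tc] /andP[]; rewrite ltNge tc.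
apply: leeD => //.
have -> : (\int[mu]_(t in `[a, (2 * a)%R]) (phi (2 ^+ n * t) * t^-1)%R%:E =
           \int[mu]_(t in `[c, (2 * c)%R]) (psi t)%:E)%E.
  by rewrite -scaled ?exprn_gt0// [in RHS](mulrCA 2).
apply: ge0_subset_integral => //.
- exact: measurable_psi.
- by move=> t; rewrite lee_fin /= in_itv/= => /andP[ta _]; apply: psi_ge0; exact: lt_le_trans ta.
- by move=> t /=; rewrite !in_itv/= => /andP[h1 ->]; rewrite ltW.
Qed.

Let dyadic_block_le (a : R) n : 0 < a ->
  (\int[mu]_(t in `[a, (2 ^+ n * a)%R]) (psi t)%:E <= M%:E)%E.
Proof.
move=> a0; apply: le_trans (dyadic_block n a0) _.
have M0 : 0 <= M by have := phi_sum 0 a0; rewrite big_ord0.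
(* On an interval of length a, 1/t <= 1/a, so dt/t has mass at most 1. *)
apply: (@le_trans _ _ (\int[mu]_(t in `[a, (2 * a)%R]) (cst (M * a^-1)%R%:E t))%E).
  apply: ge0_le_integral => //.
  - move=> t; rewrite /= in_itv/= => /andP[ta _]; rewrite lee_fin.
    by apply: sumr_ge0 => j _; rewrite mulr_ge0// invr_ge0 (le_trans (ltW a0)).
  - apply/measurable_EFinP; apply: measurable_sum => j.
    apply/measurable_EFinP; exact: measurable_phi.
  - move=> t; rewrite /= in_itv/= => /andP[ta _]; rewrite lee_fin -mulr_suml.
    have t0 : 0 < t by exact: lt_le_trans ta.
    by apply: ler_pM; rewrite ?sumr_ge0 ?invr_ge0 ?(ltW t0) ?phi_sum// lef_pV2.
have mua : mu `[a, (2 * a)%R]%classic = a%:E.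
  rewrite lebesgue_measure_itv/= lte_fin ifT; last lra.
  by rewrite -EFinB; congr (_%:E); ring.
have -> : (\int[mu]_(t in `[a, (2 * a)%R]) (cst (M * a^-1)%R%:E t) =
           (M * a^-1)%R%:E * mu `[a, (2 * a)%R]%classic)%E by exact: integral_cst.
by rewrite mua -EFinM divfK ?gt_eqF.
Qed.

Lemma dyadic_integral_le :
  (\int[mu]_(t in `]0%R, +oo[) (phi t * t^-1)%R%:E <= M%:E)%E.
Proof.
pose I n : set R := `[(2 ^- n)%R, (2 ^+ n)%R]%classic.
have p2 n : 0 < 2 ^- n :> R by rewrite invr_gt0 exprn_gt0.
have -> : `]0%R, +oo[%classic = \bigcup_n I n :> set R.
  apply/seteqP; split => t /=; last first.
    by move=> [n _]; rewrite /I /= !in_itv/= andbT => /andP[h _]; exact: lt_le_trans h.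
  rewrite in_itv/= andbT => t0.
  have [n tn] : exists n, Num.max t t^-1 <= 2 ^+ n.
    exists (Num.bound (Num.max t t^-1)); apply: ltW.
    apply: lt_le_trans (archi_boundP _) _; first by rewrite le_max ltW.
    by rewrite -natrX ler_nat ltnW// ltn_expl.
  exists n => //; rewrite /I /= in_itv/=; move: tn; rewrite ge_max => /andP[-> h].
  by rewrite andbT -[t]invrK lef_pV2 ?posrE ?invr_gt0 ?exprn_gt0.
have mI n : measurable_fun (I n) (fun t => (psi t)%:E) by exact: measurable_psi.
have mset n : measurable (I n : set (measurableTypeR R)) by exact: measurable_itv.
have ndI : nondecreasing_seq I.
  move=> n k nk; rewrite subsetEset => t; rewrite /I /= !in_itv/= => /andP[h1 h2].
  have nk2 : 2 ^+ n <= 2 ^+ k :> R by apply: ler_weXn2l => //; rewrite ler1n.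
  apply/andP; split; last exact: le_trans nk2.
  by apply: le_trans h1; rewrite lef_pV2 ?posrE ?exprn_gt0.
have psi0 n t : I n t -> (0 <= (psi t)%:E)%E.
  by rewrite lee_fin /I /= in_itv/= => /andP[h _]; apply: psi_ge0; exact: lt_le_trans h.
have := @ge0_nondecreasing_set_cvg_integral _ (measurableTypeR R) R I
  (fun t => (psi t)%:E) mu ndI mset mI psi0.
move=> /cvg_lim <- //; apply: lime_le.
  apply: ereal_nondecreasing_is_cvgn.
  exact: (@ge0_nondecreasing_set_nondecreasing_integral _ (measurableTypeR R) R I
    (fun t => (psi t)%:E) mu ndI mset mI psi0).
(* The interval from 2^(-n) to 2^n consists of 2 n doublings. *)
apply: nearW => n; have := dyadic_block_le (n + n) (p2 n).
by rewrite exprD mulfK ?gt_eqF ?exprn_gt0.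
Qed.

End DyadicIntegral.

(** * The vertical square function *)

Section UniformConvexityConstant.
Variables (R : realType) (E : normedModType R) (q : R) (e : E).
Hypothesis q0 : 0 < q.
Hypothesis e_neq0 : e != 0.

(** Test with x = 0 and y = e. On the zero space every positive K qualifies, hence the nonzero
    vector. *)
Lemma uniformly_convex_ge1 K : 0 < K -> uniformly_convex_with E q K -> 1 <= K.
Proof.
move=> K0 /(_ 0 e); rewrite normr0 powR0 ?gt_eqF// !add0r normrN -mulrDl.
rewrite (_ : 2^-1 + 2^-1 = 1) ?mul1r; last by field.
have eq0 : 0 < `|e| `^ q by apply: powR_gt0; rewrite normr_gt0.
rewrite -{2}[`|e| `^ q]mul1r ler_pM2r// powRN invf_le1 ?powR_gt0// => Kq.
rewrite leNgt; apply/negP => K1.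
have : K `^ q < 1 `^ q by rewrite gt0_ltr_powR// nnegrE ltW.
by rewrite powR1 ltNge Kq.
Qed.

Lemma Kq_ge1 : (1%:E <= Kq E q)%E.
Proof.
apply: le_ereal_inf_tmp => _ [[K [K0 ucK] <-]|->]; last exact: leey.
by rewrite lee_fin; exact: uniformly_convex_ge1.
Qed.

Lemma Kq_almost_attained : (Kq E q < +oo)%E ->
  exists2 K, 0 < K & uniformly_convex_with E q K /\ K <= 2 * fine (Kq E q).
Proof.
move=> Kfin; have K1 := Kq_ge1.
have KE : Kq E q = (fine (Kq E q))%:E.
  by rewrite fineK// fin_numE -ltNye -ltey Kfin andbT (lt_le_trans _ K1)// ltNyr.
have f1 : 1 <= fine (Kq E q) by rewrite -lee_fin -KE.
have : (Kq E q < (2 * fine (Kq E q))%:E)%E by rewrite {1}KE lte_fin; lra.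
move=> /ereal_inf_lt [_ [[K [K0 ucK] <-]|->]]; last by rewrite ltNge leey.
by rewrite lte_fin => K2; exists K => //; split => //; exact: ltW.
Qed.

End UniformConvexityConstant.

Lemma continuous_norm_powR (R : realType) (m : R) : 1 <= m ->
  continuous (fun u : R => `|u| `^ m).
Proof.
move=> m1 u; have m0 : m != 0 by rewrite gt_eqF// (lt_le_trans ltr01).
have [->|u0] := eqVneq u 0.
  rewrite /continuous_at normr0 powR0//; apply/cvgrPdist_le => e e0.
  exists (Num.min 1 e) => /=; first by rewrite lt_min ltr01.
  move=> v; rewrite /ball/= sub0r normrN lt_min => /andP[v1 ve].
  rewrite sub0r normrN ger0_norm ?powR_ge0//.
  have [->|vn] := eqVneq v 0; first by rewrite normr0 powR0// ltW.
  apply: le_trans (ltW ve); apply: ge1r_powR => //.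
  by rewrite normr_gt0 vn ltW.
apply: (@continuous_comp _ _ _ (fun u : R => `|u|) (fun u => u `^ m)).
  exact: norm_continuous.
apply/differentiable_continuous/derivable1_diffP; apply: derivable_powR.
by rewrite in_itv/= andbT normr_gt0.
Qed.

Lemma ler_poweR2r (R : realType) (r : R) (x y : \bar R) : 0 <= r ->
  (0 <= x)%E -> (x <= y)%E -> (x `^ r <= y `^ r)%E.
Proof.
move=> r0 x0 xy.
by apply: gt0_ler_poweR => //; rewrite in_itv/= leey andbT// (le_trans x0).
Qed.

Section VerticalSquareFunction.
Variables (R : realType) (E : normedModType R) (p m kappa G : R).
Local Notation T3 := ((R * R) * R)%type.
Local Notation vol := (leb3 R).
Variable f : T3 -> E.
Hypothesis f_smooth : smooth f.
Hypothesis f_compact : compact_support f.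
Hypothesis p1 : 1 < p.
Hypothesis pm : p <= m.
Hypothesis kappa0 : 0 < kappa.
Hypothesis E_convex : forall x y : E,
  `|x| `^ m + kappa * `|y| `^ m <= (2^-1 * (`|x + y| `^ p + `|x - y| `^ p)) `^ (m / p).

Let F := cc_smooth f_smooth f_compact.
Let FX := cc_X f_smooth f_compact.
Let FY := cc_Y f_smooth f_compact.
Local Notation N := (@pnorm R E p).
Local Notation tau := (@vertical_shift R E).

Hypothesis FXG : N FX <= G.
Hypothesis FYG : N FY <= G.

Let p0 : 0 < p. Proof. exact: lt_trans p1. Qed.
Let m0 : 0 < m. Proof. exact: lt_le_trans pm. Qed.

Let gap t := N (tau t F - F).

(** The triangle inequality and translation invariance reduce the difference to the displacement by
    t - s. *)
Let gap_lip s t : s <= t -> `|gap t - gap s| <= 2 * Num.sqrt (t - s) * (N FX + N FY).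
Proof.
move=> st; have ts : 0 <= t - s by rewrite subr_ge0.
have step : N (tau t F - tau s F) <= 2 * Num.sqrt (t - s) * (N FX + N FY).
  have -> : tau t F - tau s F = tau s (tau (t - s) F - F).
    by rewrite [tau s (_ - F)]linearB /= -tauD subrKC.
  by rewrite N_tau; exact: vertical_displacement_le.
have sym : N (tau s F - tau t F) = N (tau t F - tau s F).
  by rewrite -opprB -scaleN1r (pnormZ p1) normrN1 mul1r.
have tri u v : N u - N v <= N (u - v).
  by rewrite lerBlDr; apply: le_trans (pnorm_triangle p1 _ _); rewrite subrK.
have h1 := tri (tau t F - F) (tau s F - F).
have h2 := tri (tau s F - F) (tau t F - F).
rewrite opprB addrA subrK in h1; rewrite opprB addrA subrK sym in h2.
rewrite ler_norml; apply/andP; split.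
  by rewrite lerNl opprB; exact: le_trans h2 step.
exact: le_trans h1 step.
Qed.

Let gap_cont t : {for t, continuous gap}.
Proof.
apply/cvgrPdist_le => e e0.
pose D := 2 * (N FX + N FY) + 1.
have D0 : 0 < D by rewrite ltr_wpDl// mulr_ge0// addr_ge0// pnorm_ge0.
exists ((e / D) ^+ 2) => /=; first by rewrite exprn_gt0// divr_gt0.
move=> s; rewrite /ball/= => ts.
have key a : 0 <= a -> a < (e / D) ^+ 2 -> 2 * Num.sqrt a * (N FX + N FY) <= e.
  move=> a0 ad.
  have sa : Num.sqrt a <= e / D.
    have eD : 0 <= e / D by rewrite divr_ge0// ltW.
    by apply: le_trans (ler_wsqrtr (ltW ad)) _; rewrite sqrtr_sqr ger0_norm.
  have NN : 0 <= N FX + N FY by rewrite addr_ge0 ?pnorm_ge0.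
  apply: (@le_trans _ _ (Num.sqrt a * D)).
    rewrite [2 * _]mulrC -mulrA ler_wpM2l ?sqrtr_ge0// /D.
    by rewrite lerDl.
  by rewrite -ler_pdivlMr.
have [st|ts'] := leP s t.
  apply: le_trans (gap_lip st) _; apply: key; first by rewrite subr_ge0.
  by move: ts; rewrite ger0_norm ?subr_ge0.
rewrite distrC; apply: le_trans (gap_lip (ltW ts')) _; apply: key.
  by rewrite subr_ge0 ltW.
by move: ts; rewrite distrC ger0_norm ?subr_ge0 ?ltW.
Qed.

Let phi t := (gap t / Num.sqrt t) `^ m.

Let phi_cont t : 0 < t -> {for t, continuous phi}.
Proof.
move=> t0.
have c1 : {for t, continuous (fun t => gap t / Num.sqrt t)}.
  apply: cvgM; first exact: gap_cont.
  by apply: cvgV; [rewrite sqrtr_eq0 -ltNge|exact: sqrt_continuous].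
have -> : phi = (fun u : R => `|u| `^ m) \o (fun t => gap t / Num.sqrt t).
  by apply/funext => s /=; rewrite /phi ger0_norm// divr_ge0 ?sqrtr_ge0// pnorm_ge0.
apply: continuous_comp; first exact: c1.
by apply: continuous_norm_powR; exact: le_trans (ltW p1) pm.
Qed.

Lemma Lnorm_Dv t : 0 < t ->
  Lnorm vol p%:E (fun h => (`|Dv t f h|)%:E) = (gap t / Num.sqrt t)%:E.
Proof.
move=> t0; have st : 0 <= (Num.sqrt t)^-1 by rewrite invr_ge0 sqrtr_ge0.
have [u <- uE] : exists2 u : ccfun E, N u = gap t / Num.sqrt t & forall h, u h = Dv t f h.
  exists ((Num.sqrt t)^-1 *: (tau t F - F)); first by rewrite (pnormZ p1) ger0_norm// mulrC.
  move=> [[x y] z].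
  transitivity ((Num.sqrt t)^-1 *:
      (f ((x + 0, y + 0), z + (t + 0 * x + 0 * y)) - f ((x, y), z))) => //.
  by rewrite /Dv /=; congr (_ *: (_ - _)); congr (f ((_, _), _)); ring.
have -> : (N u)%:E = (pint p u `^ p^-1)%E by rewrite (pintE p1) poweR_EFin.
have pw h : (`|(`|Dv t f h|)%:E| `^ p)%E = (`|u h| `^ p)%:E by rewrite uE /= normr_id.
rewrite unlock pint_def; congr (_ `^ _)%E.
by apply: eq_integral => h _; exact: pw.
Qed.

Lemma vertical_integral_le :
  (\int[@lebesgue_measure R]_(t in `]0%R, +oo[%classic)
     ((Lnorm vol p%:E (fun h => (`|Dv t f h|)%:E)) `^ m * (t^-1)%:E) <=
   (128 `^ m / kappa * G `^ m)%:E)%E.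
Proof.
apply: (@le_trans _ _ (\int[@lebesgue_measure R]_(t in `]0%R, +oo[) (phi t * t^-1)%R%:E)%E).
  rewrite le_eqVlt; apply/orP; left; apply/eqP/eq_integral => t.
  by rewrite inE/= in_itv/= andbT => t0; rewrite Lnorm_Dv// poweR_EFin.
apply: dyadic_integral_le.
- by move=> t; exact: powR_ge0.
- exact: phi_cont.
- move=> t n t0.
  exact: (@dyadic_vertical_bound R E f f_smooth f_compact p p1 m kappa t G n pm kappa0 t0
    E_convex FXG FYG).
Qed.

End VerticalSquareFunction.

Unset Implicit Arguments.

Theorem theoremA1 (R : realType) :
  exists C : R,
  forall (p q : R) (E : completeNormedModType R) (f : (R * R) * R -> E),
    1 < p -> 2 <= q -> (Kq E q < +oo)%E ->
    smooth f -> compact_support f ->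
    let m := Num.max p q in
    ((\int[@lebesgue_measure R]_(t in `]0%R, +oo[%classic)
        ((Lnorm (leb3 R) p%:E (fun h => (`|Dv t f h|)%:E)) `^ m
           * (t^-1)%:E)) `^ m^-1
     <= (C * Num.max ((p - 1) `^ (q^-1 - 1)) (fine (Kq E q)))%:E
        * (\int[leb3 R]_h ((`|Xf f h| `^ p + `|Yf f h| `^ p)%:E)) `^ p^-1)%E.
Proof.
(* 1024 = 128 * 8, with 128 from [dyadic_translation_bound] and 8 from kappa = (8 X)^(-m). *)
exists 1024 => p q E f p1 q2 Kfin fs fc; lazy zeta.
have [m mE] : exists m, m = Num.max p q by eexists.
have [X XE] : exists X, X = Num.max ((p - 1) `^ (q^-1 - 1)) (fine (Kq E q)) by eexists.
rewrite -mE -XE.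
have p0 : 0 < p by lra.
have q0 : 0 < q by lra.
have pm : p <= m by rewrite mE le_max lexx.
have m0 : 0 < m by exact: lt_le_trans pm.
have X0 : 0 <= X by rewrite XE le_max powR_ge0.
(* A nonzero value of f supplies the nonzero vector of E that forces K_q(E) >= 1. *)
have [f0|/existsNP[h0 /eqP fh0]] := pselect (forall h, f h = 0).
  have -> : (\int[@lebesgue_measure R]_(t in `]0%R, +oo[%classic)
        ((Lnorm (leb3 R) p%:E (fun h => (`|Dv t f h|)%:E)) `^ m * (t^-1)%:E) = 0)%E.
    apply: integral0_eq => t _.
    have -> : (fun h => (`|Dv t f h|)%:E) = cst 0%E.
      by apply/funext => h; rewrite /Dv !f0 subrr scaler0 normr0.
    by rewrite Lnorm0 ?gt_eqF ?lte_fin// poweR0r ?gt_eqF// mul0e.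
  have mi : m^-1 != 0 by rewrite invr_neq0// gt_eqF.
  rewrite (poweR0r mi); apply: mule_ge0; last exact: poweR_ge0.
  by rewrite lee_fin; apply: mulr_ge0; [exact: ler0n|exact: X0].
have [K K0 [ucK KX]] := Kq_almost_attained q0 fh0 Kfin.
have K1 := uniformly_convex_ge1 q0 fh0 K0 ucK.
have f1 : 1 <= fine (Kq E q).
  rewrite -lee_fin fineK; first exact: Kq_ge1 q0 fh0.
  by rewrite fin_numE -ltNye -ltey Kfin andbT (lt_le_trans _ (Kq_ge1 q0 fh0))// ltNyr.
have X1 : 1 <= X by rewrite XE le_max f1 orbT.
have KX' : K <= 2 * X by apply: le_trans KX _; rewrite ler_pM2l// XE le_max lexx orbT.
have pX : (p - 1) `^ (q^-1 - 1) <= X by rewrite XE le_max lexx.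
have tp x y := two_point x y p1 q2 K0 ucK X1 KX' pX; rewrite -mE in tp.
have X8 : 0 < 8 * X by lra.
have kappa0 : 0 < (8 * X) `^ (- m) by exact: powR_gt0.
have bound_root (G : R) : 0 <= G ->
    ((128 `^ m / (8 * X) `^ (- m) * G `^ m)%:E `^ m^-1 = (1024 * X * G)%:E)%E.
  move=> G0; rewrite poweR_EFin powRN invrK -!powRM ?mulr_ge0 ?(ltW X8)//.
  rewrite -powRrM mulfV ?gt_eqF// powRr1 ?mulr_ge0 ?(ltW X8)//.
  by congr (_%:E); ring.
pose FX := cc_X fs fc; pose FY := cc_Y fs fc.
have massE : (\int[leb3 R]_h ((`|Xf f h| `^ p + `|Yf f h| `^ p)%:E) =
              (pmass p FX + pmass p FY)%:E)%E.
  by rewrite -(pmassD p1 FX FY); apply: eq_integral => h _; rewrite cc_XE cc_YE.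
(* The last factor of the statement, which dominates the norms of Xf and Yf separately. *)
pose G := (pmass p FX + pmass p FY) `^ p^-1.
have pi0 : 0 <= p^-1 by rewrite invr_ge0 ltW.
have XG : pnorm p FX <= G.
  by apply: (ler_powR2r pi0 (pmass_ge0 p1 FX)); rewrite lerDl (pmass_ge0 p1).
have YG : pnorm p FY <= G.
  by apply: (ler_powR2r pi0 (pmass_ge0 p1 FY)); rewrite lerDr (pmass_ge0 p1).
rewrite massE poweR_EFin -/G -EFinM.
have := vertical_integral_le p1 pm kappa0 tp XG YG.
set J := (\int[_]_(t in _) _)%E => HJ.
have J0 : (0 <= J)%E.
  apply: integral_ge0 => t; rewrite /= in_itv/= andbT => t0.
  by rewrite mule_ge0 ?poweR_ge0// lee_fin invr_ge0 ltW.
have G0 : 0 <= G by exact: powR_ge0.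
rewrite -(bound_root G G0).
by apply: (ler_poweR2r _ J0 HJ); rewrite invr_ge0 ltW.
Qed.
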